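(* The collection of all simplified three-dimensional copulas with positive density is nowhere dense in $(\mathcal{C}^3_{{\rm ac},>0},KL)$, i.e. in the set of absolutely continuous three-dimensional copulas with positive density, endowed with the topology of convergence in Kullback–Leibler divergence.
   Context: $\mathbb{I}=[0,1]$, $\lambda^k$ Lebesgue measure. $\mathcal{C}^3_{{\rm ac},>0}$ is the set of absolutely continuous three-dimensional copulas whose density is positive $\lambda^3$-a.e.; for such $C_1,C_2$ with densities $c_1,c_2$ the Kullback–Leibler divergence is $KL(C_1,C_2)=\int_{\mathbb{I}^3}c_1\log(c_1/c_2)\,d\lambda^3$. Points are written $(\mathbf{u},v)$, $\mathbf{u}=(u_1,u_2)$. For a copula $C$, $K_C$ is (a version of) the regular conditional distribution of $(U_1,U_2)$ given $U_3=v$, $(U_1,U_2,U_3)\sim C$; $F_{1|3}(u_1|t)=K_C(t,[0,u_1]\times\mathbb{I})$, $F_{2|3}(u_2|t)=K_C(t,\mathbb{I}\times[0,u_2])$. $C$ is simplified if there is a bivariate copula $A$ with $C(\mathbf{u},v)=\int_{[0,v]}A(F_{1|3}(u_1|t),F_{2|3}(u_2|t))\,d\lambda(t)$ for all $(\mathbf{u},v)$ and, for $\lambda$-a.e. $t$, $F_{1|3}(\cdot|t)$, $F_{2|3}(\cdot|t)$ are continuous. *)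

(* Defs.v *)
From HB Require Import structures.
From mathcomp Require Import all_boot all_order all_algebra.
From mathcomp Require Import all_classical all_reals all_analysis measurable_realfun.
From Stdlib Require Import ClassicalEpsilon.
Set Implicit Arguments. Unset Strict Implicit. Unset Printing Implicit Defensive.
Import Order.TTheory GRing.Theory Num.Theory.
Import numFieldNormedType.Exports.
Local Open Scope classical_set_scope.
Local Open Scope ring_scope.

Section copulas.
Variable R : realType.

Definition II : set R := `[0%R, 1%R].

Definition I0 (u : R) : set R := `[0%R, u].

Definition leb2 := ((@lebesgue_measure R) \x (@lebesgue_measure R))%E.
Definition leb3 := (leb2 \x (@lebesgue_measure R))%E.

Definition II3 : set ((R * R) * R) := (II `*` II) `*` II.

Definition is_copula2 (A : R -> R -> R) : Prop :=
  [/\ (forall x, II x -> A x 0 = 0 /\ A 0 x = 0),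
      (forall x, II x -> A x 1 = x /\ A 1 x = x) &
      (forall x1 x2 y1 y2, II x1 -> II x2 -> II y1 -> II y2 ->
         x1 <= x2 -> y1 <= y2 ->
         0 <= A x2 y2 - A x1 y2 - A x2 y1 + A x1 y1)].

Definition is_copula3 (C : R -> R -> R -> R) : Prop :=
  [/\ (forall x y, II x -> II y ->
         [/\ C 0 x y = 0, C x 0 y = 0 & C x y 0 = 0]),
      (forall x, II x -> [/\ C x 1 1 = x, C 1 x 1 = x & C 1 1 x = x]) &
      (forall a1 a2 a3 b1 b2 b3, II a1 -> II a2 -> II a3 ->
         II b1 -> II b2 -> II b3 -> a1 <= b1 -> a2 <= b2 -> a3 <= b3 ->
         0 <= C b1 b2 b3 - C a1 b2 b3 - C b1 a2 b3 - C b1 b2 a3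
              + C a1 a2 b3 + C a1 b2 a3 + C b1 a2 a3 - C a1 a2 a3)].

Definition is_density (C : R -> R -> R -> R) (c : (R * R) * R -> R) : Prop :=
  [/\ measurable_fun II3 c,
      (forall x, II3 x -> 0 <= c x) &
      (forall u1 u2 v, II u1 -> II u2 -> II v ->
         (C u1 u2 v)%:E =
         (\int[leb3]_(x in (I0 u1 `*` I0 u2) `*` I0 v) (c x)%:E)%E)].

Definition C3acpos : set (R -> R -> R -> R) :=
  [set C | is_copula3 C /\ exists c, is_density C c /\
           {ae leb3, forall x, II3 x -> 0 < c x}].

(** a (chosen) density of C; densities are unique leb3-a.e. on I^3 *)
Definition dens (C : R -> R -> R -> R) : (R * R) * R -> R :=
  epsilon (inhabits (fun _ => 0)) (fun c => is_density C c).

Definition KL (C1 C2 : R -> R -> R -> R) : \bar R :=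
  (\int[leb3]_(x in II3) ((dens C1 x) * ln (dens C1 x / dens C2 x))%:E)%E.

(** regular conditional distribution of (U1,U2) given U3 = t for C with
    density: a Markov kernel K with
    mu_C(E x G) = int_G K(t,E) dλ(t) for all Borel E ⊆ R^2, G ⊆ R. *)
Definition is_cond_kernel (C : R -> R -> R -> R)
    (K : R -> probability (R * R)%type R) : Prop :=
  (forall E, measurable E -> measurable_fun [set: R] ((fun t => K t E) : R -> \bar R)) /\
  (forall E G, measurable E -> measurable G ->
     (\int[leb3]_(x in (E `*` G) `&` II3) (dens C x)%:E =
      \int[@lebesgue_measure R]_(t in G `&` II) K t E)%E).

Definition F13 (K : R -> probability (R * R)%type R) (u1 t : R) : R :=
  fine (K t (I0 u1 `*` II)).
Definition F23 (K : R -> probability (R * R)%type R) (u2 t : R) : R :=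
  fine (K t (II `*` I0 u2)).

Definition simplified (C : R -> R -> R -> R) : Prop :=
  exists K, is_cond_kernel C K /\ exists A, is_copula2 A /\
   (forall u1 u2 v, II u1 -> II u2 -> II v ->
      (C u1 u2 v)%:E =
      (\int[@lebesgue_measure R]_(t in I0 v) (A (F13 K u1 t) (F23 K u2 t))%:E)%E) /\
   {ae @lebesgue_measure R, forall t, II t ->
      {within II, continuous (fun u => F13 K u t)} /\
      {within II, continuous (fun u => F23 K u t)}}.

Definition KLopen (U : set (R -> R -> R -> R)) : Prop :=
  U `<=` C3acpos /\
  forall C, U C -> exists2 eps : R, 0 < eps &
    forall D, C3acpos D -> (KL D C < eps%:E)%E -> U D.

Definition KLclosure (S : set (R -> R -> R -> R)) : set (R -> R -> R -> R) :=
  [set C | C3acpos C /\ forall U, KLopen U -> U C -> exists2 D, U D & S D].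

Definition KLinterior (S : set (R -> R -> R -> R)) : set (R -> R -> R -> R) :=
  [set C | exists U, [/\ KLopen U, U C & U `<=` S]].

Definition KL_nowhere_dense (S : set (R -> R -> R -> R)) : Prop :=
  KLinterior (KLclosure S) = set0.

End copulas.

(* Main.v *)
(** Convergence in KL implies convergence of the densities in L1, because
  x ln(x/y) - x + y >= (sqrt x - sqrt y)^2, so it suffices to find, KL-close to
  any simplified copula C, a copula D that no simplified copula approaches in
  L1.  Let m be the minimum of the density c of C over the four images of a point
  under u1 -> 1 - u1 and u2 -> 1 - u2, and let D have density
  d = c + eps (1 - 2 u1) (1 - 2 u2) 1_{v <= 1/2} m.  Then d has the same sections
  as c for v > 1/2 and the same conditional margins as c for all v.  Let E be
  simplified with || dens E - d ||_1 small.  For v > 1/2 the sections of C and E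
  are close, which forces their conditional copulas A and B to be close; for
  v <= 1/2 this makes E(.|v) close to C(.|v), whereas D(.|v) differs from
  C(.|v) at (1/2, 1/2). *)

(* What ties the late sections to the early ones is that a simplified copula uses a single bivariate
   copula for all t. Closeness in L1 says nothing about an individual t, so sections are compared at
   almost every fixed t, with an error proportional to the L1 distance of the two sections there,
   and the estimates are integrated over t only afterwards. The copula A is determined on the whole
   square because the conditional margins are continuous, hence have dense range in [0, 1]; this
   turns information on sections into information on A and B. The minimum over the four reflected
   images serves two purposes: lying below c, it keeps d nonnegative, and positive where c is as
   long as eps < 1; being invariant under both reflections, it lets the odd factors 1 - 2 u1 and 1 -
   2 u2 cancel along each coordinate. The resulting lower bound on the distance from d to simplified
   densities depends on eps and c alone. Densities and kernels are fixed only up to null sets, so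
   identities between sections are collected at rational endpoints. *)
Require Import Defs.
From HB Require Import structures.
From mathcomp Require Import all_boot all_order all_algebra.
From mathcomp Require Import all_classical all_reals all_analysis measurable_realfun.
From mathcomp Require Import ring lra.
Set Implicit Arguments. Unset Strict Implicit. Unset Printing Implicit Defensive.
Import Order.TTheory GRing.Theory Num.Theory.
Import numFieldNormedType.Exports.
Local Open Scope classical_set_scope.
Local Open Scope ring_scope.
Local Open Scope ereal_scope.

(* The library's sigma-finiteness instance on [m1 \x m2] is shadowed by the
   one for products of subprobabilities, hence this alias. *)
Section prod_meas.
Context d1 d2 (T1 : measurableType d1) (T2 : measurableType d2) (R : realType).
Variables (m1 : {sigma_finite_measure set T1 -> \bar R})
          (m2 : {sigma_finite_measure set T2 -> \bar R}).

Definition prod_meas : set (T1 * T2) -> \bar R := m1 \x m2.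

HB.instance Definition _ := Measure.copy prod_meas (m1 \x m2).

Lemma prod_meas_sigma_finite : sigma_finite setT prod_meas.
Proof.
have /sigma_finiteP[F [TF ndF Foo]] := sigma_finiteT m1.
have /sigma_finiteP[G [TG ndG Goo]] := sigma_finiteT m2.
exists (fun n => F n `*` G n).
  apply/seteqP; split => // -[x y] _.
  have [n _ Fx] : (\bigcup_i F i) x by rewrite -TF.
  have [k _ Gy] : (\bigcup_i G i) y by rewrite -TG.
  exists (maxn n k) => //; split.
    have /subsetPset := ndF _ _ (leq_maxl n k); exact.
  have /subsetPset := ndG _ _ (leq_maxr n k); exact.
move=> k; have [? ?] := Foo k; have [? ?] := Goo k.
split; first exact: measurableX.
rewrite /prod_meas [ltLHS]product_measure1E// lte_mul_pinfty//.
by rewrite ge0_fin_numE.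
Qed.

HB.instance Definition _ :=
  Measure_isSigmaFinite.Build _ _ _ prod_meas prod_meas_sigma_finite.

End prod_meas.

Section base.
Variable R : realType.
Local Notation mR := (measurableTypeR R).

(** These are convertible to the Lebesgue measures of the statement, but carry the sigma-finite
    structure that Tonelli's theorem asks for. *)
Definition lam : {sigma_finite_measure set mR -> \bar R} := @lebesgue_measure R.
Definition lam2 : {sigma_finite_measure set (mR * mR)%type -> \bar R} :=
  prod_meas lam lam.
Definition lam3 : {sigma_finite_measure set ((mR * mR) * mR)%type -> \bar R} :=
  prod_meas lam2 lam.

End base.

(** * Uniqueness of finite measures on products and on the line *)

Section density_measure.
Context d d' (T : measurableType d) (U : measurableType d') (R : realType).
Variables (mu : {measure set T -> \bar R}) (f : T -> \bar R) (phi : T -> U) (D : set T).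
Hypotheses (mf : measurable_fun setT f) (f0 : forall x, 0 <= f x).
Hypotheses (mphi : measurable_fun setT phi) (mD : measurable D).

(* The side conditions are parameters so that the measure structure is canonical. *)
Definition density_measure of measurable_fun setT f & (forall x, 0 <= f x) &
  measurable_fun setT phi & measurable D : set U -> \bar R :=
  fun A => \int[mu]_(x in D `&` phi @^-1` A) f x.

Local Notation nu := (density_measure mf f0 mphi mD).

Let mpre A : measurable A -> measurable (D `&` phi @^-1` A).
Proof. by move=> mA; apply: measurableI => //; rewrite -[_ @^-1` _]setTI; exact: mphi. Qed.

Let nu0 : nu set0 = 0.
Proof. by rewrite /density_measure preimage_set0 setI0 integral_set0. Qed.

Let nu_ge0 A : 0 <= nu A.
Proof. exact: integral_ge0. Qed.

Let nu_sigma_additive : semi_sigma_additive nu.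
Proof.
move=> F mF tF mUF; rewrite [X in _ --> X](_ : _ = \sum_(n <oo) nu (F n)).
  by apply/cvg_closeP; split; [exact: is_cvg_nneseries|rewrite closeE].
rewrite /density_measure preimage_bigcup setI_bigcupr ge0_integral_bigcup//.
- by move=> k; exact: mpre.
- exact: measurable_funTS.
- move=> i j _ _ [x [[_ Fi] [_ Fj]]]; apply: (tF i j) => //; by exists (phi x).
Qed.

HB.instance Definition _ := isMeasure.Build _ _ _ nu nu0 nu_ge0 nu_sigma_additive.

End density_measure.

Section uniqueness.
Context d1 d2 (T1 : measurableType d1) (T2 : measurableType d2) (R : realType).

(** Rectangles are stable under intersection and generate the product sigma-algebra, so two measures
    of finite total mass that agree on them coincide. *)
Lemma measure_prod_unique (m1 m2 : {measure set (T1 * T2) -> \bar R}) :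
  m1 setT < +oo ->
  (forall A B, measurable A -> measurable B -> m1 (A `*` B) = m2 (A `*` B)) ->
  forall S, measurable S -> m1 S = m2 S.
Proof.
move=> fin1 m12 S mS.
apply: (measure_unique [set A `*` B | A in measurable & B in measurable] (fun=> setT)) => //.
- exact: measurable_prod_measurableType.
- move=> _ _ [A mA [B mB <-]] [A' mA' [B' mB' <-]]; rewrite -setXI.
  by exists (A `&` A'); [exact: measurableI|exists (B `&` B') => //; exact: measurableI].
- by move=> _; exists setT => //; exists setT => //; rewrite setXTT.
- by rewrite bigcup_const//; exists 0%N.
- by move=> _ [A mA [B mB <-]]; exact: m12.
Qed.

(** A half-open interval is a difference of two half-lines; finiteness makes the subtraction of
    their measures legitimate. *)
Lemma measure_cdf_unique (m1 m2 : {measure set (measurableTypeR R) -> \bar R}) :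
  m1 setT < +oo ->
  (forall a, m1 `]-oo, a]%classic = m2 `]-oo, a]%classic) ->
  forall S, measurable S -> m1 S = m2 S.
Proof.
move=> fin1 m12 S mS.
have itvE a b : (a <= b)%R ->
    `]a, b]%classic = `]-oo, b]%classic `\` `]-oo, a]%classic :> set (measurableTypeR R).
  move=> ab; apply/seteqP; split => x /=; rewrite !in_itv/= -?ltNge.
    by move=> /andP[ax xb]; split => //; apply/negP; rewrite -ltNge.
  by move=> [xb /negP]; rewrite -ltNge => ax; apply/andP.
have fin A : measurable A -> m1 A < +oo.
  by move=> mA; apply: le_lt_trans fin1; apply: le_measure; rewrite ?inE.
apply: (@measure_unique _ R (measurableTypeR R) (@ocitv R) (fun n => `](- n%:R)%R, n%:R%R]%classic)) => //.
- exact: ocitvI.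
- by move=> i; exact: is_ocitv.
- exact: bigcup_itvT.
- move=> _ [[a b] _ <-] /=; have [ab|ba] := leP a b; last first.
    by rewrite set_itv_ge ?measure0// bnd_simp -leNgt ltW.
  rewrite itvE// !measureD//.
  + have -> : `]-oo, b] `&` `]-oo, a] = `]-oo, a]%classic :> set (measurableTypeR R).
      by apply/setIidr/subset_itvl; rewrite bnd_simp.
    by congr (_ - _); exact: m12.
  + by have := fin `]-oo, b]%classic; rewrite m12; apply.
  + exact: fin.
- by move=> k; apply: fin.
Qed.

End uniqueness.

(** * Tonelli's theorem on rectangles *)

Section fubini.
Context d1 d2 (T1 : measurableType d1) (T2 : measurableType d2) (R : realType).
Variables (m1 : {sigma_finite_measure set T1 -> \bar R})
          (m2 : {sigma_finite_measure set T2 -> \bar R}).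
Variables (f : T1 * T2 -> \bar R) (A : set T1) (B : set T2).
Hypotheses (mf : measurable_fun setT f) (f0 : forall x, 0 <= f x).
Hypotheses (mA : measurable A) (mB : measurable B).

(** Extension by zero reduces the integral over a rectangle to the whole product, where both
    iterated integrals are again extensions by zero. *)
Let g := f \_ (A `*` B).

Let mg : measurable_fun setT g.
Proof.
by apply/(measurable_restrictT f (measurableX mA mB)); exact: measurable_funTS.
Qed.

Let g0 x : 0 <= g x.
Proof. by rewrite /g patchE; case: ifP. Qed.

Let fubini_FE x : fubini_F m2 g x = ((fun x => \int[m2]_(y in B) f (x, y)) \_ A) x.
Proof.
rewrite /fubini_F patchE; case: ifPn => [/set_mem Ax|/negP nAx].
  rewrite [RHS]integral_mkcond; apply: eq_integral => y _.
  rewrite /g !patchE; case: ifPn => [/set_mem[_ /= By]|/negP nABy].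
    by rewrite mem_set.
  by rewrite memNset// => By; apply: nABy; rewrite inE.
rewrite integral0_eq// => y _; rewrite /g patchE memNset// => -[/= Ax _].
by apply: nAx; rewrite inE.
Qed.

Let fubini_GE y : fubini_G m1 g y = ((fun y => \int[m1]_(x in A) f (x, y)) \_ B) y.
Proof.
rewrite /fubini_G patchE; case: ifPn => [/set_mem By|/negP nBy].
  rewrite [RHS]integral_mkcond; apply: eq_integral => x _.
  rewrite /g !patchE; case: ifPn => [/set_mem[/= Ax _]|/negP nABy].
    by rewrite mem_set.
  by rewrite memNset// => Ax; apply: nABy; rewrite inE.
rewrite integral0_eq// => x _; rewrite /g patchE memNset// => -[_ /= By].
by apply: nBy; rewrite inE.
Qed.

Lemma tonelli_rect2 :
  \int[prod_meas m1 m2]_(x in A `*` B) f x = \int[m2]_(y in B) \int[m1]_(x in A) f (x, y).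
Proof.
rewrite integral_mkcond [RHS]integral_mkcond -(eq_integral _ _ (fun y _ => fubini_GE y)).
exact: (fubini_tonelli2 g).
Qed.

Lemma tonelli_rect1 :
  \int[prod_meas m1 m2]_(x in A `*` B) f x = \int[m1]_(x in A) \int[m2]_(y in B) f (x, y).
Proof.
rewrite integral_mkcond [RHS]integral_mkcond -(eq_integral _ _ (fun y _ => fubini_FE y)).
exact: (fubini_tonelli1 g).
Qed.

Lemma measurable_section2 : measurable_fun B (fun y => \int[m1]_(x in A) f (x, y)).
Proof.
apply/(measurable_restrictT _ mB); rewrite (_ : _ \_ _ = fubini_G m1 g).
  exact: measurable_fun_fubini_tonelli_G.
by apply/funext => y; rewrite fubini_GE.
Qed.

End fubini.

(** * Invariance of Lebesgue measure under x -> 1 - x *)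

Section reflection.
Variable R : realType.
Local Notation mR := (measurableTypeR R).
Local Notation lam := (@lam R).
Local Notation lam2 := (@lam2 R).
Local Notation lam3 := (@lam3 R).

Lemma measurable_reflection : measurable_fun [set: mR] (fun x : mR => (1 - x)%R : mR).
Proof. exact: measurable_funB. Qed.

(** Lebesgue measure is characterised by the lengths of half-open intervals, and the preimage of
    []a, b]] is [[1 - b, 1 - a[], of the same length. *)
Lemma lam_reflection (A : set mR) : measurable A ->
  pushforward lam (fun x : mR => (1 - x)%R : mR) A = lam A.
Proof.
move=> mA; apply/esym.
pose phi : {mfun mR >-> mR} := HB.pack (fun x : mR => (1 - x)%R : mR)
  (isMeasurableFun.Build _ _ _ _ _ measurable_reflection).
apply: (@lebesgue_measure_unique _ (pushforward lam phi)) => // _ [[a b]] _ <-.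
transitivity (lebesgue_measure (`[(1 - b)%R, (1 - a)%R[%classic : set mR)); last first.
  congr (lebesgue_measure _).
  by apply/seteqP; split => x; rewrite /= !in_itv/= => /andP[? ?]; apply/andP; split; lra.
rewrite !lebesgue_measure_itv/= !lte_fin.
rewrite (_ : (1 - b < 1 - a)%R = (a < b)%R); last by rewrite ltrD2l ltrN2.
by case: ifP => // _; rewrite -!EFinB; congr EFin; ring.
Qed.

Lemma integral_reflection (f : mR -> \bar R) (A : set mR) :
  measurable_fun setT f -> (forall x, 0 <= f x) -> measurable A ->
  A = (fun x => (1 - x)%R) @^-1` A ->
  \int[lam]_(x in A) f (1 - x)%R = \int[lam]_(x in A) f x.
Proof.
move=> mf f0 mA AE; rewrite {1}AE.
rewrite -(@ge0_integral_pushforward _ _ mR mR R _ measurable_reflection lam A f)//.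
  apply: eq_measure_integral => [|mphi B mB _]; first exact: measurable_reflection.
  exact: lam_reflection.
exact: measurable_funTS.
Qed.

End reflection.

(** * Densities on the cube are determined almost everywhere by their integrals over boxes *)

Section density_unique.
Variable R : realType.
Local Notation mR := (measurableTypeR R).
Local Notation T3 := ((mR * mR) * mR)%type.
Local Notation lam3 := (@lam3 R).

Lemma measurable_II : measurable (@II R : set mR).
Proof. exact: measurable_itv. Qed.

Lemma measurable_II3 : measurable (@II3 R : set T3).
Proof. by apply: measurableX; [apply: measurableX|]; exact: measurable_II. Qed.

Lemma eq_integral_off_cube (f : T3 -> \bar R) (S S' : set T3) : (forall x, ~ II3 x -> f x = 0) ->
  S `&` @II3 R = S' `&` @II3 R -> \int[lam3]_(x in S) f x = \int[lam3]_(x in S') f x.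
Proof.
move=> fout SS'; rewrite integral_mkcond [RHS]integral_mkcond; apply: eq_integral => x _.
have [I3|/fout fx] := pselect (II3 x); last by rewrite !patchE fx !if_same.
rewrite !patchE (_ : (x \in S) = (x \in S'))//; apply/idP/idP => /set_mem Sx; apply/mem_set.
  by have [] : (S' `&` @II3 R) x by rewrite -SS'.
by have [] : (S `&` @II3 R) x by rewrite SS'.
Qed.

Variables f1 f2 : T3 -> \bar R.
Hypotheses (mf1 : measurable_fun setT f1) (mf2 : measurable_fun setT f2).
Hypotheses (f10 : forall x, 0 <= f1 x) (f20 : forall x, 0 <= f2 x).
Hypotheses (f1_out : forall x, ~ II3 x -> f1 x = 0) (f2_out : forall x, ~ II3 x -> f2 x = 0).
Hypothesis fin1 : \int[lam3]_x f1 x < +oo.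
Hypothesis f12 : forall u1 u2 v, II u1 -> II u2 -> II v ->
  \int[lam3]_(x in (I0 u1 `*` I0 u2) `*` I0 v) f1 x =
  \int[lam3]_(x in (I0 u1 `*` I0 u2) `*` I0 v) f2 x.

(** An orthant meets the cube in the empty set if one of its bounds is negative, and otherwise in
    the box whose bounds are cut at 1. *)
Let step0 (a b v : mR) : \int[lam3]_(x in (`]-oo, a] `*` `]-oo, b]) `*` `]-oo, v]) f1 x =
  \int[lam3]_(x in (`]-oo, a] `*` `]-oo, b]) `*` `]-oo, v]) f2 x.
Proof.
have [/andP[a0 /andP[b0 v0]]|neg] := boolP [&& 0 <= a, 0 <= b & 0 <= v]%R; last first.
  have e0 : ((`]-oo, a] `*` `]-oo, b]) `*` `]-oo, v] : set T3) `&` @II3 R = set0 `&` @II3 R.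
    apply/seteqP; split => [[[x y] z]|x []//]; rewrite /= /II3 /II /= !in_itv/=.
    move=> [[[xa yb] zv] [[/andP[x0 _] /andP[y0 _]] /andP[z0 _]]]; exfalso.
    by move/negP: neg; apply; rewrite (le_trans x0)// (le_trans y0)// (le_trans z0).
  by rewrite (eq_integral_off_cube f1_out e0) (eq_integral_off_cube f2_out e0) !integral_set0.
have e0 : ((`]-oo, a] `*` `]-oo, b]) `*` `]-oo, v] : set T3) `&` @II3 R =
    ((I0 (Num.min a 1%R) `*` I0 (Num.min b 1%R)) `*` I0 (Num.min v 1%R)) `&` @II3 R.
  apply/seteqP; split => -[[x y] z] /=; rewrite /II3 /I0 /II /= !in_itv/= !le_min.
    by move=> [[[-> ->] ->] [[/andP[-> ->] /andP[-> ->]] /andP[-> ->]]].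
  by move=> [[[/and3P[_ -> _] /and3P[_ -> _]] /and3P[_ -> _]] ?].
rewrite (eq_integral_off_cube f1_out e0) (eq_integral_off_cube f2_out e0).
by apply: f12; rewrite /II/= in_itv/= le_min ge_min ler01 lexx orbT ?a0 ?b0 ?v0.
Qed.

Let fin_sub S : measurable S -> \int[lam3]_(x in S) f1 x < +oo.
Proof.
move=> mS; apply: le_lt_trans fin1; apply: ge0_subset_integral => //.
Qed.

(** One coordinate [phi] is freed from half-lines to Borel sets while the constraints on the others
    stay frozen in [D]. *)
Let step (phi : T3 -> mR) (D : set T3) : measurable_fun setT phi -> measurable D ->
  (forall a : mR, \int[lam3]_(x in D `&` phi @^-1` `]-oo, a]) f1 x =
     \int[lam3]_(x in D `&` phi @^-1` `]-oo, a]) f2 x) ->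
  forall A : set mR, measurable A -> \int[lam3]_(x in D `&` phi @^-1` A) f1 x =
     \int[lam3]_(x in D `&` phi @^-1` A) f2 x.
Proof.
move=> mphi mD agree A mA.
apply: (@measure_cdf_unique R (density_measure lam3 mf1 f10 mphi mD)
  (density_measure lam3 mf2 f20 mphi mD)) => //.
by apply: fin_sub; rewrite preimage_setT setIT.
Qed.

Let p1 (x : T3) : mR := x.1.1.
Let p2 (x : T3) : mR := x.1.2.
Let p3 (x : T3) : mR := x.2.
Let mp1 : measurable_fun setT p1. Proof. exact: measurableT_comp. Qed.
Let mp2 : measurable_fun setT p2. Proof. exact: measurableT_comp. Qed.
Let mp3 : measurable_fun setT p3. Proof. exact: measurable_snd. Qed.

Let step123 (A B G : set mR) : measurable A -> measurable B -> measurable G ->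
  \int[lam3]_(x in (A `*` B) `*` G) f1 x = \int[lam3]_(x in (A `*` B) `*` G) f2 x.
Proof.
move=> mA mB mG.
have itv (a : mR) : measurable (`]-oo, a]%classic : set mR) by exact: measurable_itv.
have H1 b v : \int[lam3]_(x in (A `*` `]-oo, b]) `*` `]-oo, v]) f1 x =
    \int[lam3]_(x in (A `*` `]-oo, b]) `*` `]-oo, v]) f2 x.
  have e (C : set mR) : (C `*` `]-oo, b]) `*` `]-oo, v] =
      ((setT `*` `]-oo, b]) `*` `]-oo, v]) `&` p1 @^-1` C.
    by apply/seteqP; split => -[[x y] z] /= []; tauto.
  rewrite e; apply: step => //; first by do 2 apply: measurableX => //.
  by move=> a; rewrite -e; exact: step0.
have H2 v : \int[lam3]_(x in (A `*` B) `*` `]-oo, v]) f1 x =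
    \int[lam3]_(x in (A `*` B) `*` `]-oo, v]) f2 x.
  have e (C : set mR) : (A `*` C) `*` `]-oo, v] = ((A `*` setT) `*` `]-oo, v]) `&` p2 @^-1` C.
    by apply/seteqP; split => -[[x y] z] /= []; tauto.
  rewrite e; apply: step => //; first by do 2 apply: measurableX => //.
  by move=> b; rewrite -e; exact: H1.
have e (C : set mR) : (A `*` B) `*` C = ((A `*` B) `*` setT) `&` p3 @^-1` C.
  by apply/seteqP; split => -[[x y] z] /= []; tauto.
rewrite e; apply: step => //; first by do 2 apply: measurableX => //.
by move=> v; rewrite -e; exact: H2.
Qed.

(** Uniqueness on products is used twice: from products of three sets to [E] times [G] with [E] in
    the plane, and from there to arbitrary sets. *)
Lemma integral_eq_of_boxes (S : set T3) : measurable S ->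
  \int[lam3]_(x in S) f1 x = \int[lam3]_(x in S) f2 x.
Proof.
have H E G : measurable E -> measurable G ->
    \int[lam3]_(x in E `*` G) f1 x = \int[lam3]_(x in E `*` G) f2 x.
  move=> mE mG; have mD : measurable ([set: mR * mR] `*` G) by exact: measurableX.
  have e (C : set (mR * mR)) : C `*` G = ([set: mR * mR] `*` G) `&` fst @^-1` C.
    by apply/seteqP; split => -[x z] /= []; tauto.
  rewrite e.
  apply: (measure_prod_unique (m1 := density_measure lam3 mf1 f10 measurable_fst mD)
    (m2 := density_measure lam3 mf2 f20 measurable_fst mD)) => //.
    by apply: fin_sub; rewrite preimage_setT setIT.
  by move=> A B mA mB; rewrite /= /density_measure -e; exact: step123.
have e (C : set T3) : C = [set: T3] `&` id @^-1` C by rewrite setTI.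
have mid : measurable_fun [set: T3] (id : T3 -> T3) by exact: measurable_id.
rewrite (e S) => mS.
apply: (measure_prod_unique (m1 := density_measure lam3 mf1 f10 mid measurableT)
  (m2 := density_measure lam3 mf2 f20 mid measurableT)) => //.
- by apply: fin_sub; rewrite preimage_setT setIT.
- by move=> A B mA mB; rewrite /= /density_measure -e; exact: H.
- by rewrite (e S).
Qed.

Lemma ae_eq_of_boxes : ae_eq lam3 setT f1 f2.
Proof.
apply: integral_ae_eq => //; last by move=> E _; exact: integral_eq_of_boxes.
apply/integrableP; split => //; under eq_integral do rewrite gee0_abs//.
exact: fin1.
Qed.

End density_unique.

(** * Kullback-Leibler divergence against the L1 distance *)

Section kullback_leibler.
Context {R : realType}.

(* Hellinger's lower bound, via [ln (sqrt (y / x)) <= sqrt (y / x) - 1]. *)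
Lemma sqr_sqrt_le_kl (x y : R) : (0 <= x -> 0 <= y -> (y = 0 -> x = 0) ->
  (Num.sqrt x - Num.sqrt y) ^+ 2 <= x * ln (x / y) - x + y)%R.
Proof.
move=> x0 y0 yx.
have [->|xN0] := eqVneq x 0%R.
  by rewrite sqrtr0 mul0r oppr0 !add0r sqrrN sqr_sqrtr.
have yN0 : y != 0%R by apply/eqP => /yx; exact/eqP.
have xp : (0 < x)%R by rewrite lt_neqAle eq_sym xN0.
have yp : (0 < y)%R by rewrite lt_neqAle eq_sym yN0.
set a := Num.sqrt x; set b := Num.sqrt y.
have ap : (0 < a)%R by rewrite sqrtr_gt0.
have bp : (0 < b)%R by rewrite sqrtr_gt0.
have -> : x = (a ^+ 2)%R by rewrite sqr_sqrtr.
have -> : y = (b ^+ 2)%R by rewrite sqr_sqrtr.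
rewrite -expr_div_n lnXn ?divr_gt0// -[(a / b)%R]invrK lnV ?posrE ?invr_gt0 ?divr_gt0// invf_div.
have h : (ln (b / a) <= b / a - 1)%R.
  rewrite -{1}[(b / a)%R](subrK 1%R) addrC; apply: le_ln1Dx.
  by rewrite ltrBrDl subrr divr_gt0.
have h2 : (a ^+ 2 * ln (b / a) <= a * b - a ^+ 2)%R.
  rewrite (_ : a * b - a ^+ 2 = a ^+ 2 * (b / a - 1))%R.
    by rewrite ler_pM2l ?exprn_gt0.
  by field; rewrite gt_eqF.
lra.
Qed.

(** With a, b the square roots of x, y, |x - y| = |a - b| (a + b). The inequality u w <= u^2 / (2
    del) + del w^2 / 2 then separates the Hellinger term from (a + b)^2 / 2 <= x + y; [del] stays
    free, to be balanced against the divergence. *)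
Lemma abs_sub_le_kl (del x y : R) : (0 < del -> 0 <= x -> 0 <= y -> (y = 0 -> x = 0) ->
  `|x - y| <= (x * ln (x / y) - x + y) / (2 * del) + del * (x + y))%R.
Proof.
move=> d0 x0 y0 yx; have := sqr_sqrt_le_kl x0 y0 yx.
set h := (_ - x + y)%R; set a := Num.sqrt x; set b := Num.sqrt y => hab.
have a0 : (0 <= a)%R by exact: sqrtr_ge0.
have b0 : (0 <= b)%R by exact: sqrtr_ge0.
have xE : x = (a ^+ 2)%R by rewrite sqr_sqrtr.
have yE : y = (b ^+ 2)%R by rewrite sqr_sqrtr.
have key (u : R) : (u * (a + b) <= u ^+ 2 / (2 * del) + del * (a + b) ^+ 2 / 2)%R.
  rewrite -subr_ge0 (_ : (_ - _)%R = ((u - del * (a + b)) ^+ 2 / (2 * del))%R).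
    by rewrite divr_ge0 ?sqr_ge0// mulr_ge0// ltW.
  by field; rewrite gt_eqF.
have ab2 : ((a + b) ^+ 2 / 2 <= x + y)%R.
  by rewrite xE yE; have := sqr_ge0 (a - b)%R; nra.
have -> : (`|x - y| = `|a - b| * (a + b))%R.
  by rewrite xE yE subr_sqr normrM (ger0_norm (addr_ge0 a0 b0)).
apply: (le_trans (key _)); rewrite real_normK ?num_real//; apply: lerD.
  by rewrite ler_pM2r// invr_gt0 mulr_gt0.
by rewrite -mulrA ler_pM2l.
Qed.

(** The logarithm is at most (x + e g) / x - 1 = e g / x <= e, and its prefactor is at most (1 + e)
    x. *)
Lemma kl_le_perturb (e x g : R) : (0 <= e <= 1 -> 0 <= x -> `|g| <= x ->
  (x + e * g) * ln ((x + e * g) / x) <= e * (1 + e) * x)%R.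
Proof.
move=> /andP[e0 e1] x0 gx.
have [x00|xN0] := eqVneq x 0%R.
  by move: gx; rewrite x00 normr_le0 => /eqP ->; rewrite mulr0 addr0 !mul0r mulr0.
have xp : (0 < x)%R by rewrite lt_neqAle eq_sym xN0.
have [g1 g2] : (- x <= g /\ g <= x)%R by move: gx; rewrite ler_norml => /andP.
have eg : (- (e * x) <= e * g /\ e * g <= e * x)%R.
  by rewrite -mulrN !ler_wpM2l.
have d0 : (0 <= x + e * g)%R by nra.
have [->|dN0] := eqVneq (x + e * g)%R 0%R; first by rewrite !mul0r !mulr_ge0// addr_ge0.
have dp : (0 < x + e * g)%R by rewrite lt_neqAle eq_sym dN0.
have : (ln ((x + e * g) / x) <= e)%R.
  rewrite (_ : ((x + e * g) / x = 1 + e * g / x)%R); last by field.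
  apply: (le_trans (le_ln1Dx _)).
    by rewrite ltr_pdivlMr// mulN1r; lra.
  by rewrite ler_pdivrMr//; case: eg.
move=> le; apply: (le_trans (ler_wpM2l d0 le)); nra.
Qed.

Lemma measurable_inv : measurable_fun [set: R] (fun x : R => x^-1%R).
Proof.
(* The right-hand side is built from measurable functions; its factor [x] makes it vanish at 0,
   matching the convention that the inverse of 0 is 0. *)
have -> : (fun x : R => x^-1%R) = (fun x => x * expR (- ln (x ^+ 2)))%R.
  apply/funext => x; have [->|xN0] := eqVneq x 0%R; first by rewrite invr0 mul0r.
  by rewrite expRN lnK ?posrE ?exprn_even_gt0//; field.
apply: measurable_funM => //; apply: measurableT_comp; first exact: measurable_expR.
apply: measurableT_comp => //; apply: measurableT_comp; first exact: measurable_ln.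
exact: measurable_funX.
Qed.

Context d (T : measurableType d) (mu : {measure set T -> \bar R}).

Definition kl (f g : T -> R) := \int[mu]_x (f x * ln (f x / g x))%:E.

Section two_densities.
Variables f g : T -> R.
Hypotheses (mf : measurable_fun setT f) (mg : measurable_fun setT g).
Hypotheses (f0 : forall x, (0 <= f x)%R) (g0 : forall x, (0 <= g x)%R).
Hypotheses (f1 : \int[mu]_x (f x)%:E = 1) (g1 : \int[mu]_x (g x)%:E = 1).

Lemma measurable_kl : measurable_fun setT (fun x => f x * ln (f x / g x))%R.
Proof.
apply: measurable_funM => //; apply: measurableT_comp; first exact: measurable_ln.
apply: measurable_funM => //; exact: measurableT_comp measurable_inv _.
Qed.

Let intf : mu.-integrable setT (EFin \o f).
Proof.
apply/integrableP; split; first exact/measurable_EFinP.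
by under eq_integral do rewrite /= ger0_norm//; rewrite f1 ltry.
Qed.

Let intg : mu.-integrable setT (EFin \o g).
Proof.
apply/integrableP; split; first exact/measurable_EFinP.
by under eq_integral do rewrite /= ger0_norm//; rewrite g1 ltry.
Qed.

(** The pointwise bound is integrated: its terms - f + g cancel because both masses are 1, and del
    (f + g) contributes 2 del. Splitting the integral requires the divergence integrand to be
    integrable, which is established beforehand. *)
Lemma L1_le_kl (del e : R) : (0 < del)%R -> (forall x, g x = 0 -> f x = 0)%R ->
  kl f g < e%:E -> \int[mu]_x `|f x - g x|%:E <= (e / (2 * del) + 2 * del)%:E.
Proof.
move=> del0 gf kle.
pose K x := (f x * ln (f x / g x))%R.
have mK : measurable_fun setT (EFin \o K) by exact/measurable_EFinP/measurable_kl.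
(* Nonnegativity of the Hellinger term gives K >= f - g >= - g, so the negative part lies below
   g. *)
have neg : \int[mu]_x (EFin \o K)^\- x <= 1.
  rewrite -g1; apply: ge0_le_integral => //; first exact: measurable_funeneg.
    exact/measurable_EFinP.
  move=> x _; rewrite funenegE ge_max; apply/andP; split; rewrite lee_fin//=.
  have := le_trans (sqr_ge0 _) (sqr_sqrt_le_kl (f0 x) (g0 x) (gf x)).
  by have := f0 x; rewrite /K; lra.
have klE : kl f g = \int[mu]_x (EFin \o K)^\+ x - \int[mu]_x (EFin \o K)^\- x.
  by rewrite /kl integralE.
(* The negative part being finite, an infinite positive part would make the divergence infinite. *)
have pos : \int[mu]_x (EFin \o K)^\+ x < +oo.
  rewrite ltNge leye_eq; apply/eqP => posoo; move: kle; rewrite klE posoo.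
  have : \int[mu]_x (EFin \o K)^\- x \is a fin_num.
    by rewrite ge0_fin_numE ?integral_ge0//; exact: le_lt_trans neg (ltry _).
  by move=> /fineK <-.
have intK : mu.-integrable setT (EFin \o K).
  apply/integrableP; split => //.
  rewrite -[X in integral _ _ X]/(abse \o (EFin \o K)) fune_abse ge0_integralD//; [|exact: measurable_funepos|exact: measurable_funeneg].
  by apply: lte_add_pinfty => //; exact: le_lt_trans neg (ltry _).
pose a := ((2 * del)^-1)%R.
apply: (@le_trans _ _ (\int[mu]_x (a * K x + ((del - a) * f x + (del + a) * g x))%:E)).
  apply: ge0_le_integral => //.
  - apply/measurable_EFinP; apply: measurableT_comp => //; exact: measurable_funB.
  - apply/measurable_EFinP; apply: measurable_funD; first exact/measurable_funM/measurable_kl.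
    by apply: measurable_funD; exact: measurable_funM.
  move=> x _; rewrite lee_fin; apply: (le_trans (abs_sub_le_kl del0 (f0 x) (g0 x) (gf x))).
  by rewrite -/(K x) -/a le_eqVlt; apply/orP; left; apply/eqP; ring.
have iZ (k : R) (h : T -> R) : mu.-integrable setT (EFin \o h) ->
    mu.-integrable setT (EFin \o (fun x => k * h x)%R).
  by move=> /(integrableZl measurableT k).
rewrite (integralD_EFin measurableT (iZ a _ intK)
  (integrableD measurableT (iZ (del - a)%R _ intf) (iZ (del + a)%R _ intg))).
rewrite (integralD_EFin measurableT (iZ (del - a)%R _ intf) (iZ (del + a)%R _ intg)).
under eq_integral do rewrite /= EFinM.
under [X in _ + (X + _)]eq_integral do rewrite /= EFinM.
under [X in _ + (_ + X)]eq_integral do rewrite /= EFinM.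
rewrite !integralZl// f1 g1 !mule1 -EFinD.
rewrite (_ : (del - a + (del + a) = 2 * del)%R); last by ring.
rewrite EFinD; apply: leeD => //; rewrite mulrC EFinM; apply: lee_wpmul2l; last exact: ltW.
by rewrite lee_fin invr_ge0 mulr_ge0// ltW.
Qed.

End two_densities.

(** Only an upper bound is wanted, so the negative part of the integrand is dropped and the positive
    part is dominated by a multiple of [f]. *)
Lemma kl_perturb_le (f g : T -> R) (e : R) :
  measurable_fun setT f -> measurable_fun setT g ->
  (forall x, (0 <= f x)%R) -> \int[mu]_x (f x)%:E = 1 ->
  (forall x, (`|g x| <= f x)%R) -> (0 <= e <= 1)%R ->
  kl (fun x => f x + e * g x)%R f <= (e * (1 + e))%:E.
Proof.
move=> mf mg f0 f1 gf e01; have /andP[e0 _] := e01.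
have mfg : measurable_fun setT (fun x => f x + e * g x)%R.
  by apply: measurable_funD => //; exact: measurable_funM.
rewrite /kl integralE; apply: (@le_trans _ _ (\int[mu]_x ((e * (1 + e)) * f x)%:E)).
  rewrite -[leRHS]sube0; apply: leeB; last exact: integral_ge0.
  apply: ge0_le_integral => //.
  - exact/measurable_funepos/measurable_EFinP/measurable_kl.
  - by apply/measurable_EFinP; exact: measurable_funM.
  - move=> x _; rewrite funeposE ge_max !lee_fin kl_le_perturb//=.
    by rewrite !mulr_ge0// addr_ge0.
under eq_integral do rewrite EFinM.
rewrite ge0_integralZl_EFin//; last 3 first.
  - by move=> x _; rewrite lee_fin.
  - exact/measurable_EFinP.
  - by rewrite mulr_ge0// addr_ge0.
by rewrite f1 mule1.
Qed.

End kullback_leibler.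

(* [filterS] and [filterS2] on an explicit measure: the search for a filter
   instance fails on [lam3] and [leb3]. *)
Section almost_everywhere.
Context d (T : measurableType d) (R : realType) (mu : {measure set T -> \bar R}).

Lemma aeS (P Q : T -> Prop) : (forall x, P x -> Q x) ->
  {ae mu, forall x, P x} -> {ae mu, forall x, Q x}.
Proof. by move=> PQ; exact: filterS. Qed.

Lemma aeS2 (P Q S : T -> Prop) : (forall x, P x -> Q x -> S x) ->
  {ae mu, forall x, P x} -> {ae mu, forall x, Q x} -> {ae mu, forall x, S x}.
Proof. by move=> PQ; exact: filterS2. Qed.

End almost_everywhere.

(** * Copula densities, extended by zero outside the cube *)

Section copula_densities.
Variable R : realType.
Local Notation mR := (measurableTypeR R).
Local Notation T3 := ((mR * mR) * mR)%type.
Local Notation lam3 := (@lam3 R).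
Local Notation II := (@II R).
Local Notation II3 := (@II3 R).

Definition box (u1 u2 v : R) : set T3 := (I0 u1 `*` I0 u2) `*` I0 v.

Lemma measurable_I0 (u : R) : measurable (I0 u : set mR).
Proof. exact: measurable_itv. Qed.

Lemma measurable_box u1 u2 v : measurable (box u1 u2 v).
Proof. by apply: measurableX; [apply: measurableX|]; exact: measurable_I0. Qed.

Lemma I01 : I0 1%R = II. Proof. by []. Qed.

Lemma I0_sub (u : R) : II u -> I0 u `<=` II.
Proof.
by rewrite /II/I0/= in_itv/= => /andP[u0 u1] x /=; rewrite !in_itv/= => /andP[-> /le_trans]; apply.
Qed.

Lemma box_sub u1 u2 v : II u1 -> II u2 -> II v -> box u1 u2 v `<=` II3.
Proof. by move=> h1 h2 h3 [[x y] z] [[/(I0_sub h1) ? /(I0_sub h2) ?] /(I0_sub h3)]. Qed.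

Lemma II_0 : II 0%R. Proof. by rewrite /II/= in_itv/= lexx ler01. Qed.
Lemma II_1 : II 1%R. Proof. by rewrite /II/= in_itv/= lexx ler01. Qed.

(** Densities are total functions vanishing off the cube, so that measurability, reflections and
    Tonelli can be used on the whole space. *)
Definition pdf3 (c : T3 -> R) := [/\ measurable_fun setT c, forall x, (0 <= c x)%R,
  forall x, ~ II3 x -> c x = 0%R & \int[lam3]_x (c x)%:E = 1].

Lemma integral_off_cube (f : T3 -> R) (S S' : set T3) : (forall x, ~ II3 x -> f x = 0%R) ->
  S `&` II3 = S' `&` II3 -> \int[lam3]_(x in S) (f x)%:E = \int[lam3]_(x in S') (f x)%:E.
Proof. by move=> fout; apply: eq_integral_off_cube => x /fout ->. Qed.

Definition cube_ext (c : T3 -> R) : T3 -> R := c \_ II3.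

Lemma cube_ext_in c x : II3 x -> cube_ext c x = c x.
Proof. by move=> ?; rewrite /cube_ext patchE mem_set. Qed.

Lemma cube_ext_out c x : ~ II3 x -> cube_ext c x = 0%R.
Proof. by move=> ?; rewrite /cube_ext patchE memNset. Qed.

Section density.
Variables (C : R -> R -> R -> R) (c : T3 -> R).
Hypotheses (copC : is_copula3 C) (densC : is_density C c).

Lemma measurable_cube_ext : measurable_fun setT (cube_ext c).
Proof. case: densC => mc _ _; rewrite /cube_ext.
by apply/(measurable_restrictT _ (@measurable_II3 R)). Qed.

Lemma cube_ext_ge0 x : (0 <= cube_ext c x)%R.
Proof.
case: densC => _ c0 _; have [h|h] := pselect (II3 x).
  by rewrite cube_ext_in ?c0.
by rewrite cube_ext_out.
Qed.

Lemma cube_ext_box u1 u2 v : II u1 -> II u2 -> II v ->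
  (C u1 u2 v)%:E = \int[lam3]_(x in box u1 u2 v) (cube_ext c x)%:E.
Proof.
case: densC => _ _ h h1 h2 h3; rewrite h//; apply: eq_integral => x /set_mem bx.
by rewrite cube_ext_in//; exact: box_sub bx.
Qed.

Lemma cube_ext_pdf : pdf3 (cube_ext c).
Proof.
split; [exact: measurable_cube_ext|exact: cube_ext_ge0|exact: cube_ext_out|].
have -> : 1 = (C 1 1 1)%R%:E by case: copC => _ /(_ 1%R II_1)[->].
rewrite (cube_ext_box II_1 II_1 II_1); apply: integral_off_cube; first exact: cube_ext_out.
by rewrite setTI setIid.
Qed.

End density.

(** The values of [C] are the box integrals of either density, and these determine a density almost
    everywhere. *)
Lemma cube_ext_unique C c1 c2 : is_copula3 C -> is_density C c1 -> is_density C c2 ->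
  {ae lam3, forall x, cube_ext c1 x = cube_ext c2 x}.
Proof.
move=> copC d1 d2.
have [m1 p1 o1 i1] := cube_ext_pdf copC d1; have [m2 p2 o2 i2] := cube_ext_pdf copC d2.
have : ae_eq lam3 setT (EFin \o cube_ext c1) (EFin \o cube_ext c2).
  apply: ae_eq_of_boxes => //=; try exact/measurable_EFinP.
  - by move=> x /o1 ->.
  - by move=> x /o2 ->.
  - by rewrite i1 ltry.
  by move=> u1 u2 v h1 h2 h3; rewrite -[LHS](cube_ext_box d1)// -[RHS](cube_ext_box d2).
by apply: filterS => x /= /(_ I)[].
Qed.

Definition cube_dens C := cube_ext (dens C).

Lemma dens_density (C : R -> R -> R -> R) : C3acpos C -> is_density C (dens C).
Proof. by move=> [_ [c [dc _]]]; apply: ClassicalEpsilon.epsilon_spec; exists c. Qed.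

Lemma cube_dens_pdf (C : R -> R -> R -> R) : C3acpos C -> pdf3 (cube_dens C).
Proof. by move=> CC; apply: cube_ext_pdf; [case: CC|exact: dens_density]. Qed.

(** Positivity is assumed for some density of [C]; uniqueness almost everywhere transfers it to the
    one picked by [epsilon]. *)
Lemma cube_dens_gt0 (C : R -> R -> R -> R) : C3acpos C -> {ae lam3, forall x, II3 x -> (0 < cube_dens C x)%R}.
Proof.
move=> CC; have := dens_density CC; have [copC [c [dc cpos]]] := CC => dC.
apply: (aeS2 (mu := lam3) _ cpos (cube_ext_unique copC dc dC)) => x /= {}cpos cc h.
by rewrite /cube_dens -cc cube_ext_in//; exact: cpos.
Qed.

Lemma KL_klE (C D : R -> R -> R -> R) : KL D C = kl lam3 (cube_dens D) (cube_dens C).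
Proof.
have -> : KL D C = \int[lam3]_(x in II3) (dens D x * ln (dens D x / dens C x))%:E by [].
rewrite /kl [LHS]integral_mkcond; apply: eq_integral => x _; rewrite patchE /cube_dens.
case: ifPn => [/set_mem h|/negP h]; first by rewrite !cube_ext_in.
by rewrite !cube_ext_out ?mul0r// => h'; apply: h; exact: mem_set.
Qed.

Lemma kl_aeE (f f' g : T3 -> R) : measurable_fun setT f -> measurable_fun setT f' ->
  measurable_fun setT g -> {ae lam3, forall x, f x = f' x} -> kl lam3 f g = kl lam3 f' g.
Proof.
move=> mf mf' mg ff'; apply: ae_eq_integral => //; try exact/measurable_EFinP/measurable_kl.
by apply: (aeS (mu := lam3) _ ff') => x /= ->.
Qed.

Lemma L1_le_KL (C D : R -> R -> R -> R) (del e : R) : C3acpos C -> C3acpos D -> (0 < del)%R -> KL D C < e%:E ->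
  \int[lam3]_x `|cube_dens D x - cube_dens C x|%:E <= (e / (2 * del) + 2 * del)%:E.
Proof.
move=> CC DD del0; rewrite KL_klE => kle.
have [mc c0 cout c1] := cube_dens_pdf CC; have [md d0 dout d1] := cube_dens_pdf DD.
(* [L1_le_kl] asks that the first density vanish at every zero of the second. This modification
   achieves it and changes the density of [D] on a null set only. *)
pose d' x := if cube_dens C x == 0%R then 0%R else cube_dens D x.
have md' : measurable_fun setT d'.
  by apply: measurable_fun_ifT => //; exact: measurable_fun_eqr.
have dd' : {ae lam3, forall x, cube_dens D x = d' x}.
  apply: (aeS (mu := lam3) _ (cube_dens_gt0 CC)) => x; rewrite /d' => pos.
  have [/pos h|h] := pselect (II3 x); first by rewrite gt_eqF.
  by rewrite dout// if_same.
have e1 : \int[lam3]_x (d' x)%:E = 1.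
  rewrite -d1; apply: ae_eq_integral => //; try exact/measurable_EFinP.
  by apply: (aeS (mu := lam3) _ dd') => x /= ->.
rewrite (_ : \int[lam3]_x _ = \int[lam3]_x `|d' x - cube_dens C x|%:E); last first.
  apply: ae_eq_integral => //.
  - by apply/measurable_EFinP/measurableT_comp => //; exact: measurable_funB.
  - by apply/measurable_EFinP/measurableT_comp => //; exact: measurable_funB.
  by apply: (aeS (mu := lam3) _ dd') => x /= ->.
apply: L1_le_kl => //.
- by move=> x; rewrite /d'; case: ifP.
- by move=> x cx; rewrite /d' cx eqxx.
- by rewrite -(kl_aeE md md' mc dd').
Qed.

End copula_densities.

(** * The copula defined by a density with uniform margins *)

Section copula_of_density.
Variable R : realType.
Local Notation mR := (measurableTypeR R).
Local Notation T3 := ((mR * mR) * mR)%type.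
Local Notation lam3 := (@lam3 R).
Local Notation II := (@II R).
Local Notation II3 := (@II3 R).

Variable d : T3 -> R.
Hypothesis pdfd : pdf3 d.

Definition mass (S : set T3) : R := fine (\int[lam3]_(x in S) (d x)%:E).

Lemma massE (S : set T3) : measurable S -> (mass S)%:E = \int[lam3]_(x in S) (d x)%:E.
Proof.
case: pdfd => md d0 _ d1 mS; rewrite fineK// ge0_fin_numE; last first.
  by apply: integral_ge0 => x _; rewrite lee_fin.
apply: (@le_lt_trans _ _ (\int[lam3]_x (d x)%:E)); last by rewrite d1 ltry.
by apply: ge0_subset_integral => //; [exact/measurable_EFinP|move=> x _; rewrite lee_fin].
Qed.

Lemma mass_ge0 S : (0 <= mass S)%R.
Proof. by case: pdfd => _ d0 _ _; apply/fine_ge0/integral_ge0 => x _; rewrite lee_fin. Qed.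

Lemma mass_split (S S1 S2 : set T3) : measurable S1 -> measurable S2 -> S = S1 `|` S2 ->
  [disjoint S1 & S2] -> mass S = (mass S1 + mass S2)%R.
Proof.
case: pdfd => md d0 _ _ m1 m2 -> dis; apply: EFin_inj; rewrite EFinD !massE//; last exact: measurableU.
rewrite ge0_integral_setU//; first exact/measurable_EFinP/measurable_funTS.
by move=> x _; rewrite lee_fin.
Qed.

Lemma mass_mono (S S' : set T3) : measurable S -> measurable S' -> S `<=` S' -> (mass S <= mass S')%R.
Proof.
case: pdfd => md d0 _ _ mS mS' SS'; rewrite -lee_fin !massE//.
apply: ge0_subset_integral => //; first exact/measurable_EFinP/measurable_funTS.
by move=> x _; rewrite lee_fin.
Qed.

Definition cdf3 (u1 u2 v : R) : R := mass (box u1 u2 v).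

Hypothesis margins : forall u, II u -> [/\ cdf3 u 1%R 1%R = u, cdf3 1%R u 1%R = u & cdf3 1%R 1%R u = u].

Let box_mono u1 u2 v w1 w2 w : (u1 <= w1 -> u2 <= w2 -> v <= w ->
  cdf3 u1 u2 v <= cdf3 w1 w2 w)%R.
Proof.
move=> h1 h2 h3; apply: mass_mono; try exact: measurable_box.
have sub (a b : R) : (a <= b)%R -> I0 a `<=` I0 b.
  by move=> ab x; rewrite /I0/= !in_itv/= => /andP[-> /le_trans]; apply.
by move=> [[x y] z] [[/(sub _ _ h1) ? /(sub _ _ h2) ?] /(sub _ _ h3)].
Qed.

(** Groundedness follows from monotonicity and the margins at 0. The alternating sum is the mass of
    a difference box, found by splitting off one coordinate at a time. *)
Lemma cdf3_copula : is_copula3 cdf3.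
Proof.
split.
- have zero a : (a <= 0 -> 0 <= a -> a = 0)%R by move=> ? ?; apply/eqP; rewrite eq_le; apply/andP.
  have [m1 m2 m3] := margins (II_0 R).
  move=> x y; rewrite /II/= !in_itv/= => /andP[x0 x1] /andP[y0 y1].
  split; (apply: zero; last exact: mass_ge0).
  + by rewrite -[leRHS]m1; exact: box_mono.
  + by rewrite -[leRHS]m2; exact: box_mono.
  + by rewrite -[leRHS]m3; exact: box_mono.
- by move=> x /margins.
move=> a1 a2 a3 b1 b2 b3 _ _ _ _ _ _ ab1 ab2 ab3.
have sp (a b : R) : (a <= b)%R -> I0 b = I0 a `|` (I0 b `\` I0 a) :> set R.
  move=> ab; rewrite setDUK// => x; rewrite /I0/= !in_itv/= => /andP[-> /le_trans]; exact.
have mI (a : R) : measurable (I0 a : set mR) := measurable_I0 a.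
have mD (a b : R) : measurable (I0 b `\` I0 a : set mR) by exact: measurableD.
have mX (X Y Z : set mR) : measurable X -> measurable Y -> measurable Z ->
  measurable ((X `*` Y) `*` Z) by move=> ? ? ?; apply: measurableX => //; exact: measurableX.
have s1 a b (Y Z : set mR) : (a <= b)%R -> measurable Y -> measurable Z ->
    mass ((I0 b `*` Y) `*` Z) = (mass ((I0 a `*` Y) `*` Z) + mass (((I0 b `\` I0 a) `*` Y) `*` Z))%R.
  move=> ab mY mZ; apply: mass_split; try exact: mX.
    rewrite [in LHS](sp a b)//; apply/seteqP; split => -[[x y] z] /=; tauto.
  by apply/disj_setPS => -[[x y] z] /= []; tauto.
have s2 a b (Y Z : set mR) : (a <= b)%R -> measurable Y -> measurable Z ->
    mass ((Y `*` I0 b) `*` Z) = (mass ((Y `*` I0 a) `*` Z) + mass ((Y `*` (I0 b `\` I0 a)) `*` Z))%R.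
  move=> ab mY mZ; apply: mass_split; try exact: mX.
    rewrite [in LHS](sp a b)//; apply/seteqP; split => -[[x y] z] /=; tauto.
  by apply/disj_setPS => -[[x y] z] /= []; tauto.
have s3 a b (Y Z : set mR) : (a <= b)%R -> measurable Y -> measurable Z ->
    mass ((Y `*` Z) `*` I0 b) = (mass ((Y `*` Z) `*` I0 a) + mass ((Y `*` Z) `*` (I0 b `\` I0 a)))%R.
  move=> ab mY mZ; apply: mass_split; try exact: mX.
    rewrite [in LHS](sp a b)//; apply/seteqP; split => -[[x y] z] /=; tauto.
  by apply/disj_setPS => -[[x y] z] /= []; tauto.
rewrite /cdf3 /box !(s1 a1 b1)// !(s2 a2 b2)// !(s3 a3 b3)//.
have := mass_ge0 (((I0 b1 `\` I0 a1) `*` (I0 b2 `\` I0 a2)) `*` (I0 b3 `\` I0 a3)).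
lra.
Qed.

Lemma cdf3_density : is_density cdf3 d.
Proof.
have [md d0 _ _] := pdfd; split => //; first exact: measurable_funTS.
by move=> u1 u2 v _ _ _; rewrite massE//; exact: measurable_box.
Qed.

End copula_of_density.

(** * The perturbed density and its pointwise properties *)

Section perturbation.
Variable R : realType.
Local Notation mR := (measurableTypeR R).
Local Notation T3 := ((mR * mR) * mR)%type.
Local Notation lam := (@lam R).
Local Notation lam2 := (@lam2 R).
Local Notation lam3 := (@lam3 R).
Local Notation II := (@II R).
Local Notation II3 := (@II3 R).

Definition refl1 (x : T3) : T3 := ((1 - x.1.1, x.1.2), x.2)%R.
Definition refl2 (x : T3) : T3 := ((x.1.1, 1 - x.1.2), x.2)%R.

Lemma refl1K : involutive refl1.
Proof. by move=> [[x y] z]; rewrite /refl1/= opprB addrC subrK. Qed.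

Lemma refl2K : involutive refl2.
Proof. by move=> [[x y] z]; rewrite /refl2/= opprB addrC subrK. Qed.

Lemma refl12C x : refl1 (refl2 x) = refl2 (refl1 x).
Proof. by []. Qed.

Let mx1 : measurable_fun [set: T3] (fun x : T3 => x.1.1 : mR).
Proof. exact: measurableT_comp. Qed.

Let mx2 : measurable_fun [set: T3] (fun x : T3 => x.1.2 : mR).
Proof. exact: measurableT_comp. Qed.

Lemma measurable_refl1 : measurable_fun setT refl1.
Proof.
apply: measurable_fun_pair; last exact: measurable_snd.
by apply: measurable_fun_pair => //; exact: measurable_funB.
Qed.

Lemma measurable_refl2 : measurable_fun setT refl2.
Proof.
apply: measurable_fun_pair; last exact: measurable_snd.
by apply: measurable_fun_pair => //; exact: measurable_funB.
Qed.

Variable c : T3 -> R.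
Hypothesis pdfc : pdf3 c.

Definition refl_min (x : T3) : R :=
  Num.min (Num.min (c x) (c (refl1 x))) (Num.min (c (refl2 x)) (c (refl1 (refl2 x)))).

Definition weight (x : T3) : R :=
  ((1 - 2 * x.1.1) * (1 - 2 * x.1.2) * (x.2 <= 2^-1)%R%:R)%R.

(** The two signs of the perturbation are kept apart, so that all cancellations take place between
    integrals of nonnegative functions. *)
Definition pert_pos (x : T3) : R := (Num.max (weight x) 0 * refl_min x)%R.
Definition pert_neg (x : T3) : R := (Num.max (- weight x) 0 * refl_min x)%R.

Definition pert (e : R) (x : T3) : R := (c x + e * (pert_pos x - pert_neg x))%R.

Lemma refl_min_refl1 x : refl_min (refl1 x) = refl_min x.
Proof.
rewrite /refl_min refl1K -refl12C refl1K.
by rewrite (minC (c (refl1 x))) (minC (c (refl1 (refl2 x)))).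
Qed.

Lemma refl_min_refl2 x : refl_min (refl2 x) = refl_min x.
Proof. by rewrite /refl_min refl2K minC. Qed.

Lemma weight_refl1 x : weight (refl1 x) = (- weight x)%R.
Proof. by rewrite /weight/=; ring. Qed.

Lemma weight_refl2 x : weight (refl2 x) = (- weight x)%R.
Proof. by rewrite /weight/=; ring. Qed.

(** A reflection flips the sign of the weight and fixes the minimum, hence exchanges the added and
    the removed mass. This is why integrating out one of the first two coordinates leaves no trace
    of the perturbation. *)
Lemma pert_pos_refl1 x : pert_pos (refl1 x) = pert_neg x.
Proof. by rewrite /pert_pos weight_refl1 refl_min_refl1. Qed.

Lemma pert_pos_refl2 x : pert_pos (refl2 x) = pert_neg x.
Proof. by rewrite /pert_pos weight_refl2 refl_min_refl2. Qed.

Lemma refl_min_ge0 x : (0 <= refl_min x)%R.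
Proof. by case: pdfc => _ c0 _ _; rewrite !le_min !c0. Qed.

Lemma refl_min_le x : (refl_min x <= c x)%R.
Proof. by rewrite /refl_min !ge_min lexx. Qed.

Lemma measurable_refl_min : measurable_fun setT refl_min.
Proof.
case: pdfc => mc _ _ _.
have m1 := measurable_refl1; have m2 := measurable_refl2.
apply: measurable_minr; apply: measurable_minr => //; try exact: (measurableT_comp mc).
by apply: (measurableT_comp mc); exact: measurableT_comp.
Qed.

Lemma measurable_weight : measurable_fun setT weight.
Proof.
apply: measurable_funM; first by apply: measurable_funM; apply: measurable_funB => //; exact: measurable_funM.
rewrite (_ : (fun _ => _) = (fun x : T3 => if x.2 <= 2^-1 then 1 else 0)%R); last first.
  by apply/funext => x; case: ifP.
apply: measurable_fun_ifT => //; apply: measurable_fun_ler => //; exact: measurable_snd.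
Qed.

Lemma measurable_pert_pos : measurable_fun setT pert_pos.
Proof.
apply: measurable_funM; last exact: measurable_refl_min.
by apply: measurable_maxr => //; exact: measurable_weight.
Qed.

Lemma measurable_pert_neg : measurable_fun setT pert_neg.
Proof.
apply: measurable_funM; last exact: measurable_refl_min.
by apply: measurable_maxr => //; apply: measurableT_comp => //; exact: measurable_weight.
Qed.

Lemma measurable_pert e : measurable_fun setT (pert e).
Proof.
case: pdfc => mc _ _ _; apply: measurable_funD => //; apply: measurable_funM => //.
by apply: measurable_funB; [exact: measurable_pert_pos|exact: measurable_pert_neg].
Qed.

Lemma pert_pos_ge0 x : (0 <= pert_pos x)%R.
Proof. by rewrite mulr_ge0 ?refl_min_ge0// le_max lexx orbT. Qed.

Lemma pert_neg_ge0 x : (0 <= pert_neg x)%R.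
Proof. by rewrite mulr_ge0 ?refl_min_ge0// le_max lexx orbT. Qed.

Lemma pert_diffE x : (pert_pos x - pert_neg x = weight x * refl_min x)%R.
Proof.
rewrite /pert_pos /pert_neg -mulrBl; congr (_ * _)%R.
by rewrite /Num.max; case: (ltP (weight x) 0%R) => h1; case: (ltP (- weight x)%R 0%R) => h2; lra.
Qed.

Lemma weight_norm x : II3 x -> (`|weight x| <= 1)%R.
Proof.
case: x => [[x y] t]; rewrite /weight /= => -[[]]; rewrite /II /= !in_itv/= => /andP[x0 x1] /andP[y0 y1] _.
rewrite !normrM -[leRHS]mul1r; apply: ler_pM => //; last by case: (t <= _)%R; rewrite ?normr1 ?normr0.
by rewrite -[leRHS]mul1r; apply: ler_pM => //; rewrite ler_norml; apply/andP; split; lra.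
Qed.

Lemma refl_min_out x : ~ II3 x -> refl_min x = 0%R.
Proof.
case: pdfc => _ _ cout _ nx; apply/eqP; rewrite eq_le refl_min_ge0 andbT.
by rewrite (le_trans (refl_min_le x))// cout.
Qed.

Lemma pert_diff_le x : (`|pert_pos x - pert_neg x| <= c x)%R.
Proof.
rewrite pert_diffE normrM (ger0_norm (refl_min_ge0 x)).
have [h|h] := pselect (II3 x); last by rewrite refl_min_out// mulr0; case: pdfc.
apply: (le_trans _ (refl_min_le x)).
by rewrite -[leRHS]mul1r ler_wpM2r ?refl_min_ge0 ?weight_norm.
Qed.

Lemma pert_pos_le x : (pert_pos x <= c x)%R.
Proof.
have [h|h] := pselect (II3 x); last by rewrite /pert_pos refl_min_out// mulr0; case: pdfc.
apply: (le_trans _ (refl_min_le x)).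
rewrite -[leRHS]mul1r ler_wpM2r ?refl_min_ge0// ge_max ler01 andbT.
exact: le_trans (ler_norm _) (weight_norm h).
Qed.

Lemma pert_ge0 e x : (0 <= e <= 1)%R -> (0 <= pert e x)%R.
Proof.
move=> /andP[e0 e1]; rewrite /pert; have := pert_diff_le x.
case: pdfc => _ /(_ x) c0 _ _; rewrite ler_norml => /andP[h _]; nra.
Qed.

Lemma pert_gt0 e x : (0 <= e < 1)%R -> (0 < c x)%R -> (0 < pert e x)%R.
Proof.
move=> /andP[e0 e1] c0; rewrite /pert; have := pert_diff_le x.
rewrite ler_norml => /andP[h _]; nra.
Qed.

Lemma pert_out e x : ~ II3 x -> pert e x = 0%R.
Proof.
move=> h; rewrite /pert /pert_pos /pert_neg refl_min_out// !mulr0 subr0 mulr0 addr0.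
by case: pdfc => _ _ ->.
Qed.

Lemma pert_late e z t : (2^-1 < t)%R -> pert e (z, t) = c (z, t).
Proof. by move=> t1; rewrite /pert pert_diffE /weight /= leNgt t1 mulr0 mul0r mulr0 addr0. Qed.

(** Both linear factors are nonnegative there, so on the lower corner square mass is only ever
    added. *)
Lemma pert_neg_corner x y t : (x <= 2^-1 -> y <= 2^-1 -> pert_neg ((x, y), t) = 0)%R.
Proof.
move=> hx hy; rewrite /pert_neg /weight /=.
rewrite max_r ?mul0r// oppr_le0 !mulr_ge0//; lra.
Qed.

Section integrals.
Context d (T : measurableType d) (mu : {measure set T -> \bar R}) (phi : T -> T3).
Hypothesis mphi : measurable_fun setT phi.
Variables (e : R) (S : set T).
Hypotheses (e01 : (0 <= e <= 1)%R) (mS : measurable S).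

(** The additive form avoids subtracting possibly infinite integrals. The map [phi] allows both the
    identity on the space and the inclusion of a section at fixed t. *)
Lemma integral_pertE :
  \int[mu]_(x in S) (pert e (phi x))%:E + e%:E * \int[mu]_(x in S) (pert_neg (phi x))%:E =
  \int[mu]_(x in S) (c (phi x))%:E + e%:E * \int[mu]_(x in S) (pert_pos (phi x))%:E.
Proof.
have /andP[e0 _] := e01; have [mc c0 _ _] := pdfc.
have mm (f : T3 -> R) : measurable_fun setT f -> measurable_fun S (fun x => (f (phi x))%:E).
  by move=> mf; apply/measurable_EFinP/measurable_funTS; exact: measurableT_comp.
have mZ (f : T3 -> R) : measurable_fun setT f -> measurable_fun S (fun x => e%:E * (f (phi x))%:E).
  by move=> mf; apply: measurable_funeM; exact: mm.
rewrite -!ge0_integralZl_EFin//; try (by move=> x _; rewrite lee_fin ?pert_neg_ge0 ?pert_pos_ge0);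
  try (by apply: mm; [exact: measurable_pert_pos|exact: measurable_pert_neg]);
  try (apply: mm; exact: measurable_pert_pos); try (apply: mm; exact: measurable_pert_neg).
have h1 x : S x -> 0 <= (c (phi x))%:E by rewrite lee_fin.
have h2 x : S x -> 0 <= e%:E * (pert_pos (phi x))%:E by rewrite mule_ge0// lee_fin// pert_pos_ge0.
have h3 x : S x -> 0 <= (pert e (phi x))%:E by rewrite lee_fin pert_ge0.
have h4 x : S x -> 0 <= e%:E * (pert_neg (phi x))%:E by rewrite mule_ge0// lee_fin// pert_neg_ge0.
have m1 := mm _ mc.
have m2 := mZ _ measurable_pert_pos.
have m3 := mm _ (measurable_pert e).
have m4 := mZ _ measurable_pert_neg.
rewrite -!ge0_integralD//.
by apply: eq_integral => x _; rewrite -!EFinM -!EFinD /pert; congr EFin; ring.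
Qed.

(** The added mass lies below [c], so its integral is finite and may be subtracted from both
    sides. *)
Lemma integral_pert_cancel :
  \int[mu]_(x in S) (c (phi x))%:E < +oo ->
  \int[mu]_(x in S) (pert_pos (phi x))%:E = \int[mu]_(x in S) (pert_neg (phi x))%:E ->
  \int[mu]_(x in S) (pert e (phi x))%:E = \int[mu]_(x in S) (c (phi x))%:E.
Proof.
have [mc c0 _ _] := pdfc.
move=> fin pn; have := integral_pertE; rewrite -pn => /eqP.
have finp : e%:E * \int[mu]_(x in S) (pert_pos (phi x))%:E \is a fin_num.
  rewrite fin_numM// ge0_fin_numE; last by apply: integral_ge0 => x _; rewrite lee_fin pert_pos_ge0.
  apply: le_lt_trans fin; apply: ge0_le_integral => //.
  - by move=> x _; rewrite lee_fin pert_pos_ge0.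
  - by apply/measurable_EFinP/measurable_funTS; apply: (measurableT_comp measurable_pert_pos).
  - by apply/measurable_EFinP/measurable_funTS; apply: (measurableT_comp mc).
  - by move=> x _; rewrite lee_fin pert_pos_le.
by move=> /eqP h; have := congr1 (fun u => u - e%:E * \int[mu]_(x in S) (pert_pos (phi x))%:E) h; rewrite /= !addeK.
Qed.

End integrals.

End perturbation.

(** * The perturbed copula: margins, density and divergence *)

Section perturbed_copula.
Variable R : realType.
Local Notation mR := (measurableTypeR R).
Local Notation T3 := ((mR * mR) * mR)%type.
Local Notation lam := (@lam R).
Local Notation lam2 := (@lam2 R).
Local Notation lam3 := (@lam3 R).
Local Notation II := (@II R).
Local Notation II3 := (@II3 R).

Lemma II_refl : II = (fun x => (1 - x)%R) @^-1` II.
Proof.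
by apply/seteqP; split => x; rewrite /preimage /Defs.II /= !in_itv/= => /andP[h1 h2]; apply/andP; split; lra.
Qed.

Section density.
Variable c : T3 -> R.
Hypothesis pdfc : pdf3 c.

Let msec (f : T3 -> R) t : measurable_fun setT f ->
  measurable_fun [set: mR * mR] (fun z => (f (z, t))%:E).
Proof. by move=> mf; apply/measurable_EFinP; exact: (measurable_fun_pair1 t mf). Qed.

(** At fixed [t] and second coordinate, reflecting the first coordinate over the whole of [II]
    exchanges the two signs. No averaging over [t] is involved, so the conditional margins are
    preserved at each [t]. *)
Lemma section_pert_symm1 (Y : set mR) (t : mR) : measurable Y ->
  \int[lam2]_(z in II `*` Y) (pert_pos c (z, t))%:E =
  \int[lam2]_(z in II `*` Y) (pert_neg c (z, t))%:E.
Proof.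
move=> mY; have mp := msec t (measurable_pert_pos pdfc); have mn := msec t (measurable_pert_neg pdfc).
rewrite (tonelli_rect2 lam lam mp _ (@measurable_II R) mY); last by move=> x; rewrite lee_fin pert_pos_ge0.
rewrite (tonelli_rect2 lam lam mn _ (@measurable_II R) mY); last by move=> x; rewrite lee_fin pert_neg_ge0.
apply: eq_integral => y _.
rewrite -(integral_reflection (measurable_fun_pair1 y mp) _ (@measurable_II R) II_refl).
  by apply: eq_integral => x _; rewrite -pert_pos_refl1.
by move=> x; rewrite lee_fin pert_pos_ge0.
Qed.

Lemma section_pert_symm2 (X : set mR) (t : mR) : measurable X ->
  \int[lam2]_(z in X `*` II) (pert_pos c (z, t))%:E =
  \int[lam2]_(z in X `*` II) (pert_neg c (z, t))%:E.
Proof.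
move=> mX; have mp := msec t (measurable_pert_pos pdfc); have mn := msec t (measurable_pert_neg pdfc).
rewrite (tonelli_rect1 lam lam mp _ mX (@measurable_II R)); last by move=> x; rewrite lee_fin pert_pos_ge0.
rewrite (tonelli_rect1 lam lam mn _ mX (@measurable_II R)); last by move=> x; rewrite lee_fin pert_neg_ge0.
apply: eq_integral => x _.
rewrite -(integral_reflection (measurable_fun_pair2 x mp) _ (@measurable_II R) II_refl).
  by apply: eq_integral => y _; rewrite -pert_pos_refl2.
by move=> y; rewrite lee_fin pert_pos_ge0.
Qed.

Variable e : R.
Hypothesis e01 : (0 <= e < 1)%R.

Let e01' : (0 <= e <= 1)%R.
Proof. by case/andP: e01 => -> /ltW. Qed.

Lemma integral_pert_eq (E : set (mR * mR)) (G : set mR) : measurable E -> measurable G ->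
  (forall t, \int[lam2]_(z in E) (pert_pos c (z, t))%:E = \int[lam2]_(z in E) (pert_neg c (z, t))%:E) ->
  \int[lam3]_(x in E `*` G) (pert c e x)%:E = \int[lam3]_(x in E `*` G) (c x)%:E.
Proof.
move=> mE mG symm; have [mc c0 _ c1] := pdfc.
have mp : measurable_fun setT (fun x => (pert_pos c x)%:E).
  by apply/measurable_EFinP; exact: measurable_pert_pos.
have mn : measurable_fun setT (fun x => (pert_neg c x)%:E).
  by apply/measurable_EFinP; exact: measurable_pert_neg.
apply: (@integral_pert_cancel R c pdfc _ _ lam3 id _ e _ e01') => //; first exact: measurableX.
  apply: (@le_lt_trans _ _ (\int[lam3]_x (c x)%:E)); last by rewrite c1 ltry.
  apply: ge0_subset_integral => //; [exact: measurableX|exact/measurable_EFinP|].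
  by move=> x _; rewrite lee_fin.
rewrite (tonelli_rect2 lam2 lam mp _ mE mG); last by move=> x; rewrite lee_fin pert_pos_ge0.
rewrite (tonelli_rect2 lam2 lam mn _ mE mG); last by move=> x; rewrite lee_fin pert_neg_ge0.
by apply: eq_integral => t _; exact: symm.
Qed.

Lemma integral_pert_eq1 (Y G : set mR) : measurable Y -> measurable G ->
  \int[lam3]_(x in (II `*` Y) `*` G) (pert c e x)%:E = \int[lam3]_(x in (II `*` Y) `*` G) (c x)%:E.
Proof.
move=> mY mG; apply: integral_pert_eq => //; first by apply: measurableX => //; exact: measurable_II.
by move=> t; exact: section_pert_symm1.
Qed.

Lemma integral_pert_eq2 (X G : set mR) : measurable X -> measurable G ->
  \int[lam3]_(x in (X `*` II) `*` G) (pert c e x)%:E = \int[lam3]_(x in (X `*` II) `*` G) (c x)%:E.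
Proof.
move=> mX mG; apply: integral_pert_eq => //; first by apply: measurableX => //; exact: measurable_II.
by move=> t; exact: section_pert_symm2.
Qed.

Lemma pert_pdf : pdf3 (pert c e).
Proof.
have [mc c0 cout c1] := pdfc; split.
- exact: measurable_pert.
- by move=> x; exact: pert_ge0.
- by move=> x; exact: pert_out.
have II3T : [set: T3] `&` II3 = II3 `&` II3 by rewrite setTI setIid.
rewrite (integral_off_cube _ II3T); last by move=> x; exact: pert_out.
rewrite -c1 (integral_off_cube cout II3T).
by apply: integral_pert_eq1; exact: measurable_II.
Qed.

End density.

Variable C : R -> R -> R -> R.
Hypothesis CC : C3acpos C.
Variable e : R.
Hypothesis e01 : (0 <= e < 1)%R.

Local Notation c := (cube_dens C).
Local Notation d := (pert c e).

Definition pert_copula := cdf3 d.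

Let pdfc : pdf3 c := cube_dens_pdf CC.
Let pdfd : pdf3 d := pert_pdf pdfc e01.

Lemma pert_copula_margins u : II u ->
  [/\ cdf3 d u 1%R 1%R = u, cdf3 d 1%R u 1%R = u & cdf3 d 1%R 1%R u = u].
Proof.
move=> Iu; have [copC _] := CC; have [_ marg _] := copC.
have [m1 m2 m3] := marg _ Iu.
have boxE u1 u2 v : II u1 -> II u2 -> II v ->
    fine (\int[lam3]_(x in box u1 u2 v) (c x)%:E) = C u1 u2 v.
  by move=> h1 h2 h3; rewrite -(cube_ext_box (dens_density CC)).
have I1 := II_1 R.
split; rewrite /cdf3 /mass.
- by rewrite integral_pert_eq2// ?boxE//; exact: measurable_I0.
- by rewrite integral_pert_eq1// ?boxE//; exact: measurable_I0.
- by rewrite integral_pert_eq1// ?boxE//; exact: measurable_I0.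
Qed.

Lemma pert_copula_C3acpos : C3acpos pert_copula.
Proof.
split; first exact: (cdf3_copula pdfd pert_copula_margins).
exists d; split; first exact: cdf3_density.
apply: (aeS (mu := lam3) _ (cube_dens_gt0 CC)) => x cpos h.
by apply: (pert_gt0 pdfc) => //; exact: cpos.
Qed.

Lemma pert_copula_dens : {ae lam3, forall x, cube_dens pert_copula x = d x}.
Proof.
apply: (aeS (mu := lam3) _ (cube_ext_unique (cdf3_copula pdfd pert_copula_margins)
  (dens_density pert_copula_C3acpos) (cdf3_density pdfd))) => x /= h.
rewrite /cube_dens h; have [I3|I3] := pselect (II3 x); first by rewrite cube_ext_in.
by rewrite cube_ext_out// pert_out.
Qed.

Lemma KL_pert_copula_le : KL pert_copula C <= (e * (1 + e))%:E.
Proof.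
have [mc c0 _ c1] := pdfc; have [md _ _ _] := pdfd.
have [mdd _ _ _] := cube_dens_pdf pert_copula_C3acpos.
rewrite KL_klE (kl_aeE mdd md mc pert_copula_dens); apply: kl_perturb_le => //.
- by apply: measurable_funB; [exact: measurable_pert_pos|exact: measurable_pert_neg].
- by move=> x; exact: pert_diff_le.
- by case/andP: e01 => -> /ltW.
Qed.

End perturbed_copula.

(** * Monotonicity, Lipschitz bounds and measurability for bivariate copulas *)

Section bivariate_copula.
Variable R : realType.
Local Notation II := (@II R).
Variable A : R -> R -> R.
Hypothesis copA : is_copula2 A.

(** The volume of [x1, x2] x [0, y] gives the lower bound, that of [x1, x2] x [y, 1] the upper
    one. *)
Lemma copula2_mono1 x1 x2 y : II x1 -> II x2 -> II y -> (x1 <= x2)%R ->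
  (0 <= A x2 y - A x1 y <= x2 - x1)%R.
Proof.
case: copA => A0 A1 Ainc Ix1 Ix2 Iy x12; have := II_0 R; have := II_1 R => I1 I0.
have y0 : (0 <= y)%R by move: Iy; rewrite /II/= in_itv/= => /andP[].
have y1 : (y <= 1)%R by move: Iy; rewrite /II/= in_itv/= => /andP[].
have [h1 _] := A0 _ Ix1; have [h2 _] := A0 _ Ix2.
have [h3 _] := A1 _ Ix1; have [h4 _] := A1 _ Ix2.
have := Ainc _ _ _ _ Ix1 Ix2 I0 Iy x12 y0; have := Ainc _ _ _ _ Ix1 Ix2 Iy I1 x12 y1.
by rewrite h1 h2 h3 h4 => ? ?; apply/andP; split; lra.
Qed.

Lemma copula2_mono2 x y1 y2 : II x -> II y1 -> II y2 -> (y1 <= y2)%R ->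
  (0 <= A x y2 - A x y1 <= y2 - y1)%R.
Proof.
case: copA => A0 A1 Ainc Ix Iy1 Iy2 y12; have := II_0 R; have := II_1 R => I1 I0.
have x0 : (0 <= x)%R by move: Ix; rewrite /II/= in_itv/= => /andP[].
have x1 : (x <= 1)%R by move: Ix; rewrite /II/= in_itv/= => /andP[].
have [_ h1] := A0 _ Iy1; have [_ h2] := A0 _ Iy2.
have [_ h3] := A1 _ Iy1; have [_ h4] := A1 _ Iy2.
have := Ainc _ _ _ _ I0 Ix Iy1 Iy2 x0 y12; have := Ainc _ _ _ _ Ix I1 Iy1 Iy2 x1 y12.
by rewrite h1 h2 h3 h4 => ? ?; apply/andP; split; lra.
Qed.

Lemma copula2_lip x y x' y' : II x -> II y -> II x' -> II y' ->
  (`|A x y - A x' y'| <= `|x - x'| + `|y - y'|)%R.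
Proof.
move=> Ix Iy Ix' Iy'.
have h1 : (`|A x y - A x' y| <= `|x - x'|)%R.
  have [xx|/ltW xx] := leP x x'.
    have /andP[? ?] := copula2_mono1 Ix Ix' Iy xx.
    by rewrite distrC (distrC x) !ger0_norm// subr_ge0.
  have /andP[? ?] := copula2_mono1 Ix' Ix Iy xx.
  by rewrite !ger0_norm// subr_ge0.
have h2 : (`|A x' y - A x' y'| <= `|y - y'|)%R.
  have [yy|/ltW yy] := leP y y'.
    have /andP[? ?] := copula2_mono2 Ix' Iy Iy' yy.
    by rewrite distrC (distrC y) !ger0_norm// subr_ge0.
  have /andP[? ?] := copula2_mono2 Ix' Iy' Iy yy.
  by rewrite !ger0_norm// subr_ge0.
have := ler_normD (A x y - A x' y)%R (A x' y - A x' y')%R.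
by rewrite addrA subrK => h; apply: (le_trans h); exact: lerD.
Qed.

Lemma copula2_ge0 x y : II x -> II y -> (0 <= A x y)%R.
Proof.
case: (copA) => A0 _ _ Ix Iy.
have x0 : (0 <= x)%R by move: Ix; rewrite /II/= in_itv/= => /andP[].
have /andP[h _] := copula2_mono1 (II_0 R) Ix Iy x0.
by move: h; have [_ ->] := A0 _ Iy; rewrite subr0.
Qed.

Lemma rat_below (x e : R) : II x -> (0 < e)%R ->
  exists q : rat, [/\ II (ratr q), (ratr q <= x)%R & (x - e < ratr q)%R].
Proof.
rewrite /II/= in_itv/= => /andP[x0 x1] e0; have [x00|xN0] := eqVneq x 0%R.
  by exists 0%R; rewrite /= in_itv/= rmorph0 !lexx ler01 x00; split=> //; lra.
have xp : (0 < x)%R by rewrite lt_neqAle eq_sym xN0.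
have [|q] := @rat_in_itvoo R (Num.max 0 (x - e))%R x.
  by rewrite gt_max xp/=; lra.
rewrite in_itv/= gt_max => /andP[/andP[q0 qe] qx]; exists q; rewrite /= in_itv/=.
by split; [apply/andP; split; lra|exact: ltW|].
Qed.

(** A superlevel set of the composition is a countable union, over rational (p, q) in the square
    with A(p, q) above the level, of the sets where f >= p and g >= q: monotonicity gives one
    inclusion, the Lipschitz bound the other. *)
Lemma measurable_copula2_comp d (T : measurableType d) (f g : T -> R) :
  measurable_fun setT f -> measurable_fun setT g ->
  (forall t, II (f t)) -> (forall t, II (g t)) -> measurable_fun setT (fun t => A (f t) (g t)).
Proof.
move=> mf mg If Ig.
apply: (measurability _ (RGenOInfty.measurableE R)) => _ [_ [a ->] <-].
rewrite setTI (_ : _ @^-1` _ = \bigcup_(p : rat) \bigcup_(q : rat)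
  if `[< [/\ II (ratr p), II (ratr q) & (a < A (ratr p) (ratr q))%R] >]
  then [set t | (ratr p <= f t)%R && (ratr q <= g t)%R] else set0).
  apply: bigcupT_measurable_rat => p; apply: bigcupT_measurable_rat => q.
  case: asboolP => // _.
  rewrite (_ : [set _ | _] = [set t | (ratr p <= f t)%R] `&` [set t | (ratr q <= g t)%R]).
    apply: measurableI.
      rewrite (_ : [set _ | _] = setT `&` f @^-1` `[ratr p, +oo[%classic).
        by apply: mf => //; exact: measurable_itv.
      by apply/seteqP; split => t /=; rewrite in_itv/= andbT => // -[].
    rewrite (_ : [set _ | _] = setT `&` g @^-1` `[ratr q, +oo[%classic).
      by apply: mg => //; exact: measurable_itv.
    by apply/seteqP; split => t /=; rewrite in_itv/= andbT => // -[].
  by apply/seteqP; split => t /=; [move=> /andP|move=> [-> ->]].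
apply/seteqP; split => t /=; rewrite in_itv/= andbT.
  (* Half the excess over the level: moving each coordinate by less than [e] lowers [A] by less than
     the whole excess. *)
  move=> aA; pose e := ((A (f t) (g t) - a) / 2)%R.
  have e0 : (0 < e)%R by rewrite divr_gt0// subr_gt0.
  have [p [Ip pf fp]] := rat_below (If t) e0; have [q [Iq qg gq]] := rat_below (Ig t) e0.
  exists p => //; exists q => //; case: asboolP => [_|]; first by rewrite /= pf qg.
  case; split => //; have := copula2_lip (If t) (Ig t) Ip Iq.
  rewrite ger0_norm ?(ger0_norm (_ : 0 <= f t - _)%R) ?(ger0_norm (_ : 0 <= g t - _)%R) ?subr_ge0//.
    rewrite /e in fp gq; lra.
  have /andP[h1 _] := copula2_mono1 Ip (If t) Iq pf.
  have /andP[h2 _] := copula2_mono2 (If t) Iq (Ig t) qg.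
  lra.
move=> [p _ [q _]]; case: asboolP => // -[Ip Iq aA] /= /andP[pf qg].
apply: (lt_le_trans aA).
have /andP[h1 _] := copula2_mono1 Ip (If t) Iq pf.
have /andP[h2 _] := copula2_mono2 (If t) Iq (Ig t) qg.
lra.
Qed.

End bivariate_copula.

(** * Rational approximation and countable intersections of almost sure events *)

Section dense_range.
Variable R : realType.

(** The intermediate value theorem yields an exact preimage of [p]; continuity then permits
    replacing it by a nearby rational, chosen inside the unit interval. *)
Lemma rat_dense_range (f : R -> R) (p e : R) : {within @II R, continuous f} ->
  f 0%R = 0%R -> f 1%R = 1%R -> II p -> (0 < e)%R ->
  exists q : rat, II (ratr q : R) /\ (`|f (ratr q) - p| < e)%R.
Proof.
move=> cf f0 f1; rewrite /II/= in_itv/= => /andP[p0 p1] e0.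
have [|u] := @IVT R f 0%R 1%R p ler01 cf.
  by rewrite f0 f1 ge_min le_max p0 p1 orbT.
rewrite in_itv/= => /andP[u0 u1] fu.
have Iu : II u by rewrite /II/= in_itv/= u0 u1.
have /subspace_continuousP/(_ _ Iu)/cvgrPdist_lt/(_ _ e0) := cf.
rewrite /within/= => /nbhs_ballP[r /= r0 hr].
have [|q] := @rat_in_itvoo R (Num.max 0 (u - r))%R (Num.min 1 (u + r))%R.
  by rewrite gt_max !lt_min; apply/andP; split; apply/andP; split; lra.
rewrite in_itv/= gt_max lt_min => /andP[/andP[q0 qr] /andP[q1 qr']].
have Iq : II (ratr q : R) by rewrite /II/= in_itv/= !ltW.
exists q; split => //; rewrite -fu distrC; apply: hr => //.
by rewrite /ball/= ltr_norml; apply/andP; split; lra.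
Qed.

Lemma ae_forall_rat d (T : measurableType d) (mu : {measure set T -> \bar R}) (P : rat -> T -> Prop) :
  (forall q, {ae mu, forall t, P q t}) -> {ae mu, forall t, forall q, P q t}.
Proof.
move=> h; have := @ae_foralln _ T R mu (fun n t => if unpickle n is Some q then P q t else True).
move=> /(_ _)H; have {}H : {ae mu, forall t, forall n, if unpickle n is Some q then P q t else True}.
  by apply: H => n; case: unpickle => [q|]; [exact: h|exact: aeW].
by apply: aeS H => t ht q; have := ht (pickle q); rewrite pickleK.
Qed.

End dense_range.

(** * Sections of a density and the conditional kernel *)

Section sections.
Variable R : realType.
Local Notation mR := (measurableTypeR R).
Local Notation T3 := ((mR * mR) * mR)%type.
Local Notation lam := (@lam R).
Local Notation lam2 := (@lam2 R).
Local Notation lam3 := (@lam3 R).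
Local Notation II := (@II R).
Local Notation II3 := (@II3 R).
Let mII : measurable (II : set mR) := @measurable_II R.

Definition sec (f : T3 -> R) (S : set (mR * mR)) (t : mR) : \bar R :=
  \int[lam2]_(z in S) (f (z, t))%:E.

Lemma sec_ge0 (f : T3 -> R) S t : (forall x, (0 <= f x)%R) -> 0 <= sec f S t.
Proof. by move=> f0; apply: integral_ge0 => z _; rewrite lee_fin. Qed.

Lemma integral_sec (f : T3 -> R) S (G : set mR) : measurable_fun setT f -> (forall x, (0 <= f x)%R) ->
  measurable S -> measurable G ->
  \int[lam3]_(x in S `*` G) (f x)%:E = \int[lam]_(t in G) sec f S t.
Proof.
move=> mf f0 mS mG; have mf' : measurable_fun setT (EFin \o f) by exact/measurable_EFinP.
exact: (tonelli_rect2 lam2 lam mf').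
Qed.

Lemma measurable_sec (f : T3 -> R) S : measurable_fun setT f -> (forall x, (0 <= f x)%R) ->
  measurable S -> measurable_fun setT (sec f S).
Proof.
move=> mf f0 mS; have mf' : measurable_fun setT (EFin \o f) by exact/measurable_EFinP.
exact: (measurable_section2 lam2 mf').
Qed.

Lemma ae_eq_of_cdf (f1 f2 : mR -> \bar R) :
  measurable_fun setT f1 -> measurable_fun setT f2 ->
  (forall t, 0 <= f1 t) -> (forall t, 0 <= f2 t) -> \int[lam]_(t in II) f1 t < +oo ->
  (forall v, II v -> \int[lam]_(t in I0 v) f1 t = \int[lam]_(t in I0 v) f2 t) ->
  {ae lam, forall t, II t -> f1 t = f2 t}.
Proof.
move=> m1 m2 f10 f20 fin f12.
have mid : measurable_fun setT (id : mR -> mR) by exact: measurable_id.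
suff H (S : set mR) : measurable S ->
    \int[lam]_(t in II `&` id @^-1` S) f1 t = \int[lam]_(t in II `&` id @^-1` S) f2 t.
  apply: integral_ae_eq => //.
  - apply/integrableP; split; first exact: measurable_funTS.
    by under eq_integral do rewrite gee0_abs//; exact: fin.
  - exact: measurable_funTS.
  by move=> E EII mE; rewrite -(setIidr EII); exact: H.
move=> mS; apply: (measure_cdf_unique (m1 := density_measure lam m1 f10 mid mII)
  (m2 := density_measure lam m2 f20 mid mII)) => //.
  by rewrite /= /density_measure preimage_setT setIT.
move=> a; rewrite /= /density_measure preimage_id.
have [a0|a0] := ltP a 0%R.
  rewrite (_ : II `&` _ = set0) ?integral_set0//; apply/seteqP; split => // t [] /=.
  by rewrite /Defs.II/= !in_itv/= => /andP[t0 _] ta; have := le_lt_trans (le_trans t0 ta) a0; rewrite ltxx.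
rewrite (_ : II `&` _ = I0 (Num.min a 1%R)).
  by apply: f12; rewrite /Defs.II/= in_itv/= le_min ge_min a0 ler01 lexx orbT.
apply/seteqP; split => t /=; rewrite /Defs.II /I0/= !in_itv/= le_min.
  by move=> [/andP[-> ->] ->].
by move=> /and3P[-> -> ->].
Qed.

Section conditional_kernel.
Variables (C : R -> R -> R -> R) (K : R -> probability (R * R)%type R).
Hypotheses (CC : C3acpos C) (kerK : is_cond_kernel C K).
Local Notation c := (cube_dens C).

(** By Tonelli, both functions of [t] have the same integral over every Borel subset of [II], and
    [K t E <= 1] provides integrability. The exceptional null set depends on [E]. *)
Lemma cond_kernel_section (E : set (mR * mR)) : measurable E ->
  {ae lam, forall t, II t -> K t E = sec c E t}.
Proof.
move=> mE; have [mc c0 cout c1] := cube_dens_pdf CC; have [mK intK] := kerK.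
have mK' : measurable_fun II ((fun t => K t E) : mR -> \bar R).
  by apply: measurable_funTS; exact: mK.
have ms : measurable_fun II (sec c E) by apply: measurable_funTS; exact: measurable_sec.
apply: integral_ae_eq => //.
  apply/integrableP; split => //.
  apply: (@le_lt_trans _ _ (\int[lam]_(t in II) (cst 1 t))).
    apply: ge0_le_integral => //; first exact: measurableT_comp.
    by move=> t _; rewrite gee0_abs//; exact: probability_le1.
  rewrite integral_cst// mul1e [ltLHS]lebesgue_measure_itv/=.
  by rewrite lte_fin ltr01 -EFinB ltry.
move=> G GII mG; rewrite -integral_sec//.
transitivity (\int[lam]_(t in G `&` II) K t E); first by rewrite setIidl.
transitivity (\int[lam3]_(x in (E `*` G) `&` II3) (dens C x)%:E).
  by apply: esym; exact: intK.
rewrite [LHS]integral_mkcond [RHS]integral_mkcond; apply: eq_integral => x _.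
rewrite !patchE; have [h|h] := pselect (II3 x).
  rewrite /cube_dens cube_ext_in// (_ : (x \in _ `&` _) = (x \in E `*` G))//.
  by apply/idP/idP => /set_mem; [case=> ? _|move=> ?]; exact/mem_set.
rewrite memNset; last by case.
by rewrite /cube_dens cube_ext_out// if_same.
Qed.

Lemma F13_section (u : R) : {ae lam, forall t, II t -> F13 K u t = fine (sec c (I0 u `*` II) t)}.
Proof.
have mE : measurable (I0 u `*` II : set (mR * mR)) by apply: measurableX => //; exact: measurable_I0.
by apply: (aeS (mu := lam) _ (cond_kernel_section mE)) => t h It; rewrite /F13 -h.
Qed.

Lemma F23_section (u : R) : {ae lam, forall t, II t -> F23 K u t = fine (sec c (II `*` I0 u) t)}.
Proof.
have mE : measurable (II `*` I0 u : set (mR * mR)) by apply: measurableX => //; exact: measurable_I0.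
by apply: (aeS (mu := lam) _ (cond_kernel_section mE)) => t h It; rewrite /F23 -h.
Qed.

Lemma sec_total : {ae lam, forall t, II t -> sec c (II `*` II) t = 1}.
Proof.
apply: (aeS (mu := lam) _ (cond_kernel_section measurableT)) => t h It.
rewrite -(probability_setT (K t)) h// /sec.
have [_ _ cout _] := cube_dens_pdf CC.
rewrite [LHS]integral_mkcond; apply: eq_integral => z _; rewrite patchE.
case: ifPn => // /negP hz; rewrite cout// => -[hz' _].
by apply: hz; exact/mem_set.
Qed.

Let mfine_K (E : set (mR * mR)) : measurable E ->
  measurable_fun setT ((fun t => fine (K t E)) : mR -> R).
Proof. by move=> mE; have [mK _] := kerK; apply: measurableT_comp => //; exact: mK. Qed.

Let fine_K_II (E : set (mR * mR)) t : measurable E -> II (fine (K t E)).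
Proof.
move=> mE; rewrite /Defs.II/= in_itv/= fine_ge0//= -lee_fin fineK ?fin_num_measure//.
exact: probability_le1.
Qed.

(** Over each initial interval [I0 v] both sides integrate to [C u1 u2 v]: the left by the density,
    the right by the simplifying identity. *)
Lemma simplified_section (A : R -> R -> R) (u1 u2 : R) : is_copula2 A -> II u1 -> II u2 ->
  (forall v, II v -> (C u1 u2 v)%:E =
     \int[@lebesgue_measure R]_(t in I0 v) (A (F13 K u1 t) (F23 K u2 t))%:E) ->
  {ae lam, forall t, II t -> sec c (I0 u1 `*` I0 u2) t = (A (F13 K u1 t) (F23 K u2 t))%:E}.
Proof.
move=> copA I1 I2 CA; have [mc c0 cout c1] := cube_dens_pdf CC.
have m1 : measurable (I0 u1 `*` II : set (mR * mR)) by apply: measurableX => //; exact: measurable_I0.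
have m2 : measurable (II `*` I0 u2 : set (mR * mR)) by apply: measurableX => //; exact: measurable_I0.
have m12 : measurable (I0 u1 `*` I0 u2 : set (mR * mR)).
  by apply: measurableX; exact: measurable_I0.
apply: ae_eq_of_cdf.
- exact: measurable_sec.
- apply/measurable_EFinP; apply: (measurable_copula2_comp copA (mfine_K m1) (mfine_K m2)).
    by move=> t; exact: fine_K_II.
  by move=> t; exact: fine_K_II.
- by move=> t; exact: sec_ge0.
- by move=> t; rewrite lee_fin; apply: (copula2_ge0 copA); exact: fine_K_II.
- rewrite -integral_sec// -(I01 R) -[X in integral _ X]/(box u1 u2 1%R).
  by rewrite -(cube_ext_box (dens_density CC))// ?ltry//; exact: II_1.
- move=> v Iv; rewrite -integral_sec//; last exact: measurable_I0.
  rewrite -[X in integral _ X]/(box u1 u2 v) -(cube_ext_box (dens_density CC))//.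
  exact: CA.
Qed.

End conditional_kernel.
End sections.

(** * Comparison of two simplified copulas at a fixed t *)

Section good_sections.
Variable R : realType.
Local Notation mR := (measurableTypeR R).
Local Notation T3 := ((mR * mR) * mR)%type.
Local Notation lam := (@lam R).
Local Notation lam2 := (@lam2 R).
Local Notation II := (@II R).
Let mII : measurable (II : set mR) := @measurable_II R.

(** What a simplified copula provides at almost every [t]. Rational endpoints keep the exceptional
    set null; dense ranges of the conditional margins, together with the Lipschitz property, make
    the identity at rational endpoints determine [A] on the whole square. *)
Definition good_section (c : T3 -> R) (A : R -> R -> R) (t : R) : Prop :=
  [/\ sec c (II `*` II) t = 1,
      (forall q1 q2 : rat, II (ratr q1) -> II (ratr q2) ->
        fine (sec c (I0 (ratr q1) `*` I0 (ratr q2)) t) =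
        A (fine (sec c (I0 (ratr q1) `*` II) t)) (fine (sec c (II `*` I0 (ratr q2)) t))),
      (forall p e : R, II p -> (0 < e)%R -> exists q : rat,
        II (ratr q : R) /\ (`|fine (sec c (I0 (ratr q) `*` II) t) - p| < e)%R) &
      (forall p e : R, II p -> (0 < e)%R -> exists q : rat,
        II (ratr q : R) /\ (`|fine (sec c (II `*` I0 (ratr q)) t) - p| < e)%R)].

Let sec_I00_l (c : T3 -> R) t : pdf3 c -> sec c (I0 0%R `*` II) t = 0.
Proof.
move=> [mc c0 _ _]; rewrite /sec.
have mf : measurable_fun [set: mR * mR] (fun z => (c (z, t))%:E).
  by apply/measurable_EFinP; exact: (measurable_fun_pair1 t mc).
rewrite (tonelli_rect1 lam lam mf _ (measurable_I0 0%R) mII); last by move=> z; rewrite lee_fin.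
by rewrite /I0 set_itv1 integral_set1.
Qed.

Let sec_I00_r (c : T3 -> R) t : pdf3 c -> sec c (II `*` I0 0%R) t = 0.
Proof.
move=> [mc c0 _ _]; rewrite /sec.
have mf : measurable_fun [set: mR * mR] (fun z => (c (z, t))%:E).
  by apply/measurable_EFinP; exact: (measurable_fun_pair1 t mc).
rewrite (tonelli_rect2 lam lam mf _ mII (measurable_I0 0%R)); last by move=> z; rewrite lee_fin.
by rewrite /I0 set_itv1 integral_set1.
Qed.

(** Continuity is available for [F13 K] and [F23 K], which at almost every [t] are known to equal
    the integrals of the section at rational endpoints only; the approximating points therefore have
    to be rational. *)
Lemma simplified_good (C : R -> R -> R -> R) : C3acpos C -> simplified C ->
  exists2 A, is_copula2 A & {ae lam, forall t, II t -> good_section (cube_dens C) A t}.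
Proof.
move=> CC [K [kerK [A [copA [CA cont]]]]]; exists A => //.
have cont' : {ae lam, forall t, II t -> {within II, continuous (fun u => F13 K u t)} /\
  {within II, continuous (fun u => F23 K u t)}} := cont.
have pdfc := cube_dens_pdf CC.
have H1 := ae_forall_rat (fun q : rat => F13_section CC kerK (ratr q : R)).
have H2 := ae_forall_rat (fun q : rat => F23_section CC kerK (ratr q : R)).
have H3 : {ae lam, forall t, forall q1 q2 : rat, II (ratr q1) -> II (ratr q2) -> II t ->
    sec (cube_dens C) (I0 (ratr q1) `*` I0 (ratr q2)) t =
    (A (F13 K (ratr q1) t) (F23 K (ratr q2) t))%:E}.
  apply: ae_forall_rat => q1; apply: ae_forall_rat => q2.
  have [I1|I1] := pselect (II (ratr q1 : R)); last by apply: aeW.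
  have [I2|I2] := pselect (II (ratr q2 : R)); last by apply: aeW.
  apply: (aeS (mu := lam) _ (simplified_section CC kerK copA I1 I2 (fun v => CA _ _ v I1 I2))).
  by move=> t h _ _; exact: h.
have H4 := sec_total CC kerK.
apply: (aeS2 (mu := lam) _ (aeS2 (mu := lam) (fun t a b => conj a b) H1 H2)
  (aeS2 (mu := lam) (fun t a b => conj a b) H3
    (aeS2 (mu := lam) (fun t a b => conj a b) H4 cont'))).
move=> t [h1 h2] [h3 [h4 h5]] It.
have ratr0 : ratr 0 = 0%R :> R by rewrite rmorph0.
have ratr1 : ratr 1 = 1%R :> R by rewrite rmorph1.
have [c1 c2] := h5 It.
split.
- exact: h4.
- by move=> q1 q2 I1 I2; rewrite h3//= h1// h2.
- move=> p e Ip e0; have [] := @rat_dense_range R (fun u => F13 K u t) p e c1 _ _ Ip e0.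
  + by have := h1 0%R It; rewrite ratr0 sec_I00_l.
  + by have := h1 1%R It; rewrite ratr1 I01 h4.
  by move=> q [Iq qe]; exists q; rewrite -h1.
- move=> p e Ip e0; have [] := @rat_dense_range R (fun u => F23 K u t) p e c2 _ _ Ip e0.
  + by have := h2 0%R It; rewrite ratr0 sec_I00_r.
  + by have := h2 1%R It; rewrite ratr1 I01 h4.
  by move=> q [Iq qe]; exists q; rewrite -h2.
Qed.

Definition abs_diff (f g : T3 -> R) (x : T3) : R := `|f x - g x|%R.

Section section_estimates.
Variables (c e : T3 -> R) (A B : R -> R -> R) (eps t : R).
Hypotheses (pdfc : pdf3 c) (pdfe : pdf3 e) (eps01 : (0 <= eps < 1)%R).
Hypotheses (copA : is_copula2 A) (copB : is_copula2 B).
Hypotheses (goodA : good_section c A t) (goodB : good_section e B t).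
Local Notation d := (pert c eps).
Let pdfd : pdf3 d := pert_pdf pdfc eps01.
Let eps01' : (0 <= eps <= 1)%R.
Proof. by case/andP: eps01 => -> /ltW. Qed.

Local Notation dist := (abs_diff e d).
Local Notation eta := (fine (sec dist (II `*` II) t)).

Let mS12 : measurable (II `*` II : set (mR * mR)).
Proof. exact: measurableX. Qed.

Let msec (f : T3 -> R) (S : set (mR * mR)) : measurable_fun setT f ->
  measurable_fun S (fun z => (f (z, t))%:E).
Proof.
by move=> mf; apply/measurable_funTS/measurable_EFinP; exact: (measurable_fun_pair1 t mf).
Qed.

Let sec_mono (f : T3 -> R) (S : set (mR * mR)) : measurable_fun setT f -> (forall x, (0 <= f x)%R) ->
  measurable S -> S `<=` II `*` II -> sec f S t <= sec f (II `*` II) t.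
Proof.
move=> mf f0 mS SI; apply: ge0_subset_integral => //; first exact: msec.
by move=> x _; rewrite lee_fin.
Qed.

Let sec_fin (f : T3 -> R) (S : set (mR * mR)) : measurable_fun setT f -> (forall x, (0 <= f x)%R) ->
  sec f (II `*` II) t = 1 -> measurable S -> S `<=` II `*` II -> sec f S t \is a fin_num.
Proof.
move=> mf f0 f1 mS SI; rewrite ge0_fin_numE ?sec_ge0//.
by apply: (le_lt_trans (sec_mono mf f0 mS SI)); rewrite f1 ltry.
Qed.

Let sec_II (f : T3 -> R) (S : set (mR * mR)) : measurable_fun setT f -> (forall x, (0 <= f x)%R) ->
  sec f (II `*` II) t = 1 -> measurable S -> S `<=` II `*` II -> II (fine (sec f S t)).
Proof.
move=> mf f0 f1 mS SI; rewrite /Defs.II/= in_itv/= fine_ge0 ?sec_ge0//=.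
by rewrite -lee_fin fineK ?sec_fin// -f1; exact: sec_mono.
Qed.

Let mc : measurable_fun setT c. Proof. by case: pdfc. Qed.
Let me : measurable_fun setT e. Proof. by case: pdfe. Qed.
Let md : measurable_fun setT d. Proof. by case: pdfd. Qed.
Let c0 x : (0 <= c x)%R. Proof. by case: pdfc. Qed.
Let e0 x : (0 <= e x)%R. Proof. by case: pdfe. Qed.
Let d0 x : (0 <= d x)%R. Proof. by case: pdfd. Qed.
Let c1 : sec c (II `*` II) t = 1. Proof. by case: goodA. Qed.
Let e1 : sec e (II `*` II) t = 1. Proof. by case: goodB. Qed.

Let sec_margin1 (S : set mR) : measurable S -> S `<=` II -> sec d (II `*` S) t = sec c (II `*` S) t.
Proof.
move=> mS SI; have mE : measurable (II `*` S : set (mR * mR)) by exact: measurableX.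
apply: (@integral_pert_cancel R c pdfc _ _ lam2 (fun z => (z, t)) _ eps _ eps01') => //.
  rewrite -[ltLHS]/(sec c (II `*` S) t) -ge0_fin_numE ?sec_ge0//.
  by apply: sec_fin => // -[x y] [? ?]; split => //; exact: SI.
exact: section_pert_symm1.
Qed.

Let sec_margin2 (S : set mR) : measurable S -> S `<=` II -> sec d (S `*` II) t = sec c (S `*` II) t.
Proof.
move=> mS SI; have mE : measurable (S `*` II : set (mR * mR)) by exact: measurableX.
apply: (@integral_pert_cancel R c pdfc _ _ lam2 (fun z => (z, t)) _ eps _ eps01') => //.
  rewrite -[ltLHS]/(sec c (S `*` II) t) -ge0_fin_numE ?sec_ge0//.
  by apply: sec_fin => // -[x y] [? ?]; split => //; exact: SI.
exact: section_pert_symm2.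
Qed.

Let d1 : sec d (II `*` II) t = 1.
Proof. by rewrite sec_margin1. Qed.

Let mdist : measurable_fun setT dist.
Proof. by apply: measurableT_comp => //; exact: measurable_funB. Qed.

Lemma sec_dist_fin : sec dist (II `*` II) t \is a fin_num.
Proof.
rewrite ge0_fin_numE; last by apply: sec_ge0 => x; exact: normr_ge0.
apply: (@le_lt_trans _ _ (sec e (II `*` II) t + sec d (II `*` II) t)); last first.
  by rewrite e1 d1 -EFinD ltry.
rewrite /sec -ge0_integralD//; try exact: msec; try by move=> x _; rewrite lee_fin.
apply: ge0_le_integral => //.
- by move=> x _; rewrite lee_fin normr_ge0.
- exact: msec.
- by apply: emeasurable_funD; exact: msec.
move=> x _; rewrite -EFinD lee_fin; apply: (le_trans (ler_normB _ _)).
by rewrite !ger0_norm.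
Qed.

Let sec_diff (S : set (mR * mR)) : measurable S -> S `<=` II `*` II ->
  (`|fine (sec e S t) - fine (sec d S t)| <= eta)%R.
Proof.
move=> mS SI.
have dS : sec dist S t <= sec dist (II `*` II) t.
  by apply: sec_mono => // ?; exact: normr_ge0.
have half (f g : T3 -> R) : measurable_fun setT f -> measurable_fun setT g ->
    (forall x, (0 <= f x)%R) -> (forall x, (0 <= g x)%R) -> (forall x, dist x = `|f x - g x|%R) ->
    sec f (II `*` II) t = 1 -> sec g (II `*` II) t = 1 ->
    (fine (sec f S t) - fine (sec g S t) <= eta)%R.
  move=> mf mg f0 g0 fg f1 g1; rewrite lerBlDl -lee_fin EFinD !fineK ?sec_dist_fin ?sec_fin//.
  apply: (@le_trans _ _ (sec g S t + sec dist S t)); last exact: leeD2l.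
  rewrite /sec -ge0_integralD//; try exact: msec; try by move=> x _; rewrite lee_fin ?normr_ge0.
  apply: ge0_le_integral => //.
  - by move=> x _; rewrite lee_fin.
  - exact: msec.
  - by apply: emeasurable_funD; exact: msec.
  by move=> x _; rewrite -EFinD lee_fin fg -lerBlDl ler_norm.
rewrite ler_norml lerNl opprB; apply/andP; split; apply: half => //.
by move=> x; rewrite /abs_diff distrC.
Qed.

(** Three errors of at most [eta] each: passing from [d] to [e] on the box, and on each of the two
    margins inside the Lipschitz function [B]. The margins of [d] are those of [c]. *)
Let B_close (q1 q2 : rat) : II (ratr q1 : R) -> II (ratr q2 : R) ->
  (`|fine (sec d (I0 (ratr q1) `*` I0 (ratr q2)) t) -
   B (fine (sec c (I0 (ratr q1) `*` II) t)) (fine (sec c (II `*` I0 (ratr q2)) t))| <= 3 * eta)%R.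
Proof.
move=> I1 I2; have s1 := I0_sub I1; have s2 := I0_sub I2.
have m1 := measurable_I0 (ratr q1 : R); have m2 := measurable_I0 (ratr q2 : R).
have mX1 : measurable (I0 (ratr q1) `*` II : set (mR * mR)) by exact: measurableX.
have mX2 : measurable (II `*` I0 (ratr q2) : set (mR * mR)) by exact: measurableX.
have mX12 : measurable (I0 (ratr q1) `*` I0 (ratr q2) : set (mR * mR)) by exact: measurableX.
have S1 : I0 (ratr q1) `*` II `<=` II `*` II by move=> [x y] [/s1 ? ?].
have S2 : II `*` I0 (ratr q2) `<=` II `*` II by move=> [x y] [? /s2 ?].
have S12 : I0 (ratr q1) `*` I0 (ratr q2) `<=` II `*` II by move=> [x y] [/s1 ? /s2 ?].
have [_ eB _ _] := goodB.
have h1 := sec_diff mX1 S1; rewrite sec_margin2// in h1.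
have h2 := sec_diff mX2 S2; rewrite sec_margin1// in h2.
have h12 := sec_diff mX12 S12; rewrite eB// in h12.
have := copula2_lip copB (sec_II me e0 e1 mX1 S1) (sec_II me e0 e1 mX2 S2)
  (sec_II mc c0 c1 mX1 S1) (sec_II mc c0 c1 mX2 S2) => hB.
have := ler_distD (B (fine (sec e (I0 (ratr q1) `*` II) t)) (fine (sec e (II `*` I0 (ratr q2)) t)))
  (fine (sec d (I0 (ratr q1) `*` I0 (ratr q2)) t))
  (B (fine (sec c (I0 (ratr q1) `*` II) t)) (fine (sec c (II `*` I0 (ratr q2)) t))).
move=> h; apply: (le_trans h); rewrite distrC in h12.
by move: hB h1 h2 h12; lra.
Qed.

(** Here the box integrals of [d] and [c] coincide, so [B_close] compares [A] and [B] at the same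
    pair of margins of [c]; such pairs come arbitrarily close to (p, q). *)
Lemma late_estimate (p q : R) : (2^-1 < t)%R -> II p -> II q ->
  `|A p q - B p q|%:E <= 3%:E * sec dist (II `*` II) t.
Proof.
move=> t1 Ip Iq; rewrite -(fineK sec_dist_fin) -EFinM lee_fin; apply/ler_addgt0Pr => del del0.
have [_ cA dense1 dense2] := goodA.
(* Both [A] and [B] are moved in two coordinates, which makes four errors in total. *)
have del4 : (0 < del / 4)%R by rewrite divr_gt0.
have [q1 [I1 h1]] := dense1 _ _ Ip del4; have [q2 [I2 h2]] := dense2 _ _ Iq del4.
have s1 := I0_sub I1; have s2 := I0_sub I2.
have m1 := measurable_I0 (ratr q1 : R); have m2 := measurable_I0 (ratr q2 : R).
have J1 : II (fine (sec c (I0 (ratr q1) `*` II) t)).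
  by apply: sec_II => //; [exact: measurableX|move=> [x y] [/s1 ? ?]].
have J2 : II (fine (sec c (II `*` I0 (ratr q2)) t)).
  by apply: sec_II => //; [exact: measurableX|move=> [x y] [? /s2 ?]].
have := B_close I1 I2.
have -> : sec d (I0 (ratr q1) `*` I0 (ratr q2)) t = sec c (I0 (ratr q1) `*` I0 (ratr q2)) t.
  by apply: eq_integral => z _; rewrite pert_late.
rewrite cA//; set x := fine _ in h1 J1 *; set y := fine _ in h2 J2 *.
have := copula2_lip copA Ip Iq J1 J2; have := copula2_lip copB J1 J2 Ip Iq.
have := ler_distD (A x y) (A p q) (B p q); have := ler_distD (B x y) (A x y) (B p q).
move: h1 h2; rewrite (distrC x) (distrC y); move: (distrC p x) (distrC q y); lra.
Qed.

(** On the corner square the box integral of [d] is the value of [A] at the margins of [c] plus the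
    whole added mass, while [B_close] puts it near the value of [B] at the same margins. A gap
    between [A] and [B] of at most [s] thus bounds the added mass. *)
Lemma early_estimate (s : R) :
  (forall p q, II p -> II q -> `|A p q - B p q| <= s)%R ->
  eps%:E * sec (pert_pos c) (I0 2^-1%R `*` I0 2^-1%R) t <= 3%:E * sec dist (II `*` II) t + s%:E.
Proof.
(* The corner 1/2 is the image of a rational, so the identities of [good_section] apply to it
   exactly. *)
move=> ABs; have half : ratr (2%:R^-1)%R = 2^-1%R :> R by rewrite fmorphV/= ratr_nat.
have Ih : II (2^-1%R : R) by rewrite /Defs.II/= in_itv/=; apply/andP; split; lra.
have := @B_close (2%:R^-1)%R (2%:R^-1)%R; rewrite !half => /(_ Ih Ih) hB.
have [_ cA _ _] := goodA; have := cA (2%:R^-1)%R (2%:R^-1)%R; rewrite !half => /(_ Ih Ih) hA.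
have sh := I0_sub Ih; have mh := measurable_I0 (2^-1%R : R).
have J1 : II (fine (sec c (I0 2^-1%R `*` II) t)).
  by apply: sec_II => //; [exact: measurableX|move=> [x y] [/sh ? ?]].
have J2 : II (fine (sec c (II `*` I0 2^-1%R) t)).
  by apply: sec_II => //; [exact: measurableX|move=> [x y] [? /sh ?]].
have mS : measurable (I0 2^-1%R `*` I0 2^-1%R : set (mR * mR)) by exact: measurableX.
have SI : I0 2^-1%R `*` I0 2^-1%R `<=` II `*` II by move=> [x y] [/sh ? /sh ?].
have finpos : sec (pert_pos c) (I0 2^-1%R `*` I0 2^-1%R) t \is a fin_num.
  rewrite ge0_fin_numE; last by apply: sec_ge0 => x; exact: pert_pos_ge0.
  have := sec_fin mc c0 c1 mS SI; rewrite ge0_fin_numE ?sec_ge0//; apply: le_lt_trans.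
  apply: ge0_le_integral => //.
  - by move=> x _; rewrite lee_fin pert_pos_ge0.
  - by apply: msec; exact: measurable_pert_pos.
  - exact: msec.
  by move=> x _; rewrite lee_fin pert_pos_le.
rewrite -(fineK finpos) -(fineK sec_dist_fin) -!EFinM -EFinD lee_fin.
move: hA hB; have -> : fine (sec d (I0 2^-1%R `*` I0 2^-1%R) t) =
    (fine (sec c (I0 2^-1%R `*` I0 2^-1%R) t) +
     eps * fine (sec (pert_pos c) (I0 2^-1%R `*` I0 2^-1%R) t))%R.
  have mphi : measurable_fun setT (fun z : mR * mR => (z, t : mR)) by exact: pair2_measurable.
  have := @integral_pertE R c pdfc _ _ lam2 (fun z => (z, t)) mphi eps _ eps01' mS.
  rewrite (_ : \int[lam2]_(z in _) (pert_neg c (z, t))%:E = 0); last first.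
    apply: integral0_eq => -[x y] []; rewrite /I0 /= !in_itv/= => /andP[_ hx] /andP[_ hy].
    by rewrite pert_neg_corner.
  rewrite mule0 adde0 => h; apply: EFin_inj; rewrite EFinD EFinM !fineK ?finpos ?sec_fin//.
move=> ->; have := ABs _ _ J1 J2.
set a := A _ _; set b := B _ _; set g := (eps * _)%R.
have := ler_norm (a - b)%R; have := ler_norm (b - a)%R; rewrite (distrC b a).
have := ler_norm (a + g - b)%R; lra.
Qed.

End section_estimates.
End good_sections.

(** * Positivity of the mass added in the corner *)

Section final_estimate.
Variable R : realType.
Local Notation mR := (measurableTypeR R).
Local Notation T3 := ((mR * mR) * mR)%type.
Local Notation lam := (@lam R).
Local Notation lam2 := (@lam2 R).
Local Notation lam3 := (@lam3 R).
Local Notation II := (@II R).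
Local Notation II3 := (@II3 R).
Local Notation refl1 := (@refl1 R).
Local Notation refl2 := (@refl2 R).
Let mII : measurable (II : set mR) := @measurable_II R.

Lemma integral_refl1 (f : T3 -> \bar R) : measurable_fun setT f -> (forall x, 0 <= f x) ->
  \int[lam3]_x f (refl1 x) = \int[lam3]_x f x.
Proof.
move=> mf f0; have mf1 : measurable_fun setT (f \o refl1).
  by apply: measurableT_comp => //; exact: measurable_refl1.
rewrite [LHS](fubini_tonelli2 (m1 := lam2) (m2 := lam) _ mf1 (fun=> f0 _)) [RHS](fubini_tonelli2 (m1 := lam2) (m2 := lam) _ mf f0).
apply: eq_integral => t _.
have mft : measurable_fun setT (fun z : mR * mR => f (z, t)) := measurable_fun_pair1 t mf.
have mf1t : measurable_fun setT (fun z : mR * mR => f (refl1 (z, t))) := measurable_fun_pair1 t mf1.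
rewrite /fubini_G [LHS](fubini_tonelli2 (m1 := lam) (m2 := lam) _ mf1t (fun=> f0 _)) [RHS](fubini_tonelli2 (m1 := lam) (m2 := lam) _ mft (fun=> f0 _)).
apply: eq_integral => y _.
by rewrite /fubini_G /fubini_F -(integral_reflection (measurable_fun_pair1 y mft)).
Qed.

Lemma integral_refl2 (f : T3 -> \bar R) : measurable_fun setT f -> (forall x, 0 <= f x) ->
  \int[lam3]_x f (refl2 x) = \int[lam3]_x f x.
Proof.
move=> mf f0; have mf1 : measurable_fun setT (f \o refl2).
  by apply: measurableT_comp => //; exact: measurable_refl2.
rewrite [LHS](fubini_tonelli2 (m1 := lam2) (m2 := lam) _ mf1 (fun=> f0 _)) [RHS](fubini_tonelli2 (m1 := lam2) (m2 := lam) _ mf f0).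
apply: eq_integral => t _.
have mft : measurable_fun setT (fun z : mR * mR => f (z, t)) := measurable_fun_pair1 t mf.
have mf1t : measurable_fun setT (fun z : mR * mR => f (refl2 (z, t))) := measurable_fun_pair1 t mf1.
rewrite /fubini_G [LHS](fubini_tonelli1 (m1 := lam) (m2 := lam) _ mf1t (fun=> f0 _)) [RHS](fubini_tonelli1 (m1 := lam) (m2 := lam) _ mft (fun=> f0 _)).
apply: eq_integral => x _.
by rewrite /fubini_G /fubini_F -(integral_reflection (measurable_fun_pair2 x mft)).
Qed.

(** Invariance of the integral, applied to the indicator of a null set, shows that its preimage is
    null. *)
Let ae_refl (r : T3 -> T3) (P : T3 -> Prop) : measurable_fun setT r ->
  (forall f : T3 -> \bar R, measurable_fun setT f -> (forall x, 0 <= f x) ->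
     \int[lam3]_x f (r x) = \int[lam3]_x f x) ->
  {ae lam3, forall x, P x} -> {ae lam3, forall x, P (r x)}.
Proof.
move=> mr inv [N [mN N0 PN]]; exists (r @^-1` N); split.
- by rewrite -[_ @^-1` _]setTI; exact: mr.
- have mrN : measurable (r @^-1` N) by rewrite -[_ @^-1` _]setTI; exact: mr.
  have m1N : measurable_fun setT (fun x => (\1_N x)%:E : \bar R) by exact/measurable_EFinP.
  transitivity (\int[lam3]_x (\1_(r @^-1` N) x)%:E); first by rewrite integral_indic// setIT.
  rewrite -N0 -[in RHS](setIT N) -integral_indic// -(inv _ m1N)//.
- by move=> x /= Px; exact: PN.
Qed.

Lemma ae_refl1 (P : T3 -> Prop) : {ae lam3, forall x, P x} -> {ae lam3, forall x, P (refl1 x)}.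
Proof. by apply: ae_refl; [exact: measurable_refl1|exact: integral_refl1]. Qed.

Lemma ae_refl2 (P : T3 -> Prop) : {ae lam3, forall x, P x} -> {ae lam3, forall x, P (refl2 x)}.
Proof. by apply: ae_refl; [exact: measurable_refl2|exact: integral_refl2]. Qed.

Variable c : T3 -> R.
Hypotheses (pdfc : pdf3 c) (cpos : {ae lam3, forall x, II3 x -> (0 < c x)%R}).

Lemma refl_min_gt0 : {ae lam3, forall x, II3 x -> (0 < refl_min c x)%R}.
Proof.
have r (x : R) : II x -> II (1 - x)%R by rewrite {1}(II_refl R).
have r1 x : II3 x -> II3 (refl1 x).
  by case: x => [[x y] t] [[/= hx hy] ht]; split => //; split => //; exact: r.
have r2 x : II3 x -> II3 (refl2 x).
  by case: x => [[x y] t] [[/= hx hy] ht]; split => //; split => //; exact: r.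
have h1 := ae_refl1 cpos; have h2 := ae_refl2 cpos; have h12 := ae_refl2 (ae_refl1 cpos).
apply: (aeS2 (mu := lam3) _ (aeS2 (mu := lam3) (fun t a b => conj a b) cpos h1)
  (aeS2 (mu := lam3) (fun t a b => conj a b) h2 h12)).
move=> x [c0 c1] [c2 c12] Ix; rewrite /refl_min !lt_min c0// c1 ?c2 ?c12//; try exact: r1; try exact: r2.
by apply: r1; exact: r2.
Qed.

Definition corner_mass : \bar R :=
  \int[lam3]_(x in box 2^-1 2^-1 2^-1) (pert_pos c x)%:E.

(** If the integral were zero, the added mass would vanish almost everywhere on the corner box; but
    almost everywhere on a subset of measure 1/8 both the weight and [refl_min] are positive. *)
Lemma corner_mass_gt0 : 0 < corner_mass.
Proof.
have pos0 x : 0 <= (pert_pos c x)%:E by rewrite lee_fin pert_pos_ge0.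
have mpos : measurable_fun setT (fun x => (pert_pos c x)%:E).
  by apply/measurable_EFinP; exact: measurable_pert_pos.
rewrite lt_neqAle integral_ge0 ?andbT//; apply/eqP => rho0.
(* Half-open, because the weight vanishes where a coordinate equals 1/2; the third coordinate may
   reach 1/2, where the indicator is still 1. *)
pose h : set mR := `[0%R, 2^-1%R[%classic.
have mh : measurable h by exact: measurable_itv.
pose hb : set T3 := (h `*` h) `*` I0 2^-1%R.
have mhh : measurable (h `*` h : set (mR * mR)) by exact: measurableX.
have m0 := measurable_I0 (2^-1%R : R).
have lamh : lam h = (2^-1%R)%:E.
  by rewrite [LHS]lebesgue_measure_itv/= lte_fin invr_gt0 ltr0n oppr0 adde0.
have lamI : lam (I0 2^-1%R) = (2^-1%R)%:E.
  by rewrite [LHS]lebesgue_measure_itv/= lte_fin invr_gt0 ltr0n oppr0 adde0.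
have hb_pos : 0 < lam3 hb.
  rewrite [ltRHS](product_measure1E lam2 lam mhh m0) [X in _ < X * _](product_measure1E lam lam mh mh).
  rewrite [lam h]lamh lamI [X in _ < X * _ * _]lamh -!EFinM lte_fin.
  by rewrite !mulr_gt0// invr_gt0.
have ae0 : ae_eq lam3 (box 2^-1 2^-1 2^-1) (fun x => (pert_pos c x)%:E) (cst 0).
  apply/(ae_eq_integral_abs lam3 (measurable_box _ _ _)); first exact: measurable_funTS.
  by under eq_integral do rewrite gee0_abs//; rewrite -/corner_mass -rho0.
have nohb : {ae lam3, forall x, ~ hb x}.
  apply: (aeS2 (mu := lam3) _ ae0 refl_min_gt0) => -[[x y] t] p0 m_pos [[/= hx hy] ht].
  move: hx hy ht (hx) (hy) (ht); rewrite {1 2}/h /I0 /= !in_itv/= => /andP[x0 x1] /andP[y0 y1] /andP[t0 t1] hx hy ht.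
  have Ix : II3 ((x, y), t).
    by split; [split|]; rewrite /= /Defs.II /= in_itv/=; apply/andP; split; lra.
  have {}p0 := p0 _; have : (pert_pos c ((x, y), t))%:E = 0.
    by apply: p0; split; [split|]; rewrite /I0/= in_itv/= ?x0 ?y0 ?t0 ?(ltW x1) ?(ltW y1).
  move=> [] /eqP; rewrite gt_eqF// /pert_pos mulr_gt0 ?m_pos// lt_max /weight /= t1 mulr1.
  by rewrite mulr_gt0//; lra.
have : lam3.-negligible hb.
  move: nohb => [N [mN N0 PN]]; exists N; split => // x hx; apply: PN => /=; exact.
have mhb : measurable hb by exact: measurableX.
move=> /(measure_negligible mhb) h0.
by move: hb_pos; rewrite [lam3 hb]h0 ltxx.
Qed.

End final_estimate.

(** * Separation of the perturbed density from all simplified copulas *)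

Section separation.
Variable R : realType.
Local Notation mR := (measurableTypeR R).
Local Notation T3 := ((mR * mR) * mR)%type.
Local Notation lam := (@lam R).
Local Notation lam2 := (@lam2 R).
Local Notation lam3 := (@lam3 R).
Local Notation II := (@II R).
Let mII : measurable (II : set mR) := @measurable_II R.

Section simplified_pair.
Variables (C E : R -> R -> R -> R) (eps : R).
Hypotheses (CC : C3acpos C) (CE : C3acpos E) (eps01 : (0 <= eps < 1)%R).
Hypotheses (simC : simplified C) (simE : simplified E).
Local Notation c := (cube_dens C).
Local Notation e := (cube_dens E).
Local Notation dist := (abs_diff e (pert c eps)).

Let pdfc := cube_dens_pdf CC.
Let pdfe := cube_dens_pdf CE.
Let pdfd := pert_pdf pdfc eps01.

Lemma measurable_dist : measurable_fun setT dist.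
Proof.
have [me _ _ _] := pdfe; have [md _ _ _] := pdfd.
by apply: measurableT_comp => //; exact: measurable_funB.
Qed.

Lemma dist_ge0 x : (0 <= dist x)%R.
Proof. exact: normr_ge0. Qed.

Let N := \int[lam3]_x (dist x)%:E.

Let N_fin : N \is a fin_num.
Proof.
have [me e0 _ e1] := pdfe; have [md d0 _ d1] := pdfd.
rewrite ge0_fin_numE; last by apply: integral_ge0 => x _; rewrite lee_fin dist_ge0.
apply: (@le_lt_trans _ _ (\int[lam3]_x ((e x)%:E + (pert c eps x)%:E))); last first.
  rewrite ge0_integralD//; try exact/measurable_EFinP; try by move=> x _; rewrite lee_fin.
  by rewrite e1 d1 -EFinD ltry.
apply: ge0_le_integral => //.
- by move=> x _; rewrite lee_fin dist_ge0.
- by apply/measurable_EFinP; exact: measurable_dist.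
- by apply: emeasurable_funD; exact/measurable_EFinP.
move=> x _; rewrite -EFinD lee_fin; apply: (le_trans (ler_normB _ _)).
by rewrite !ger0_norm.
Qed.

Let mS12 : measurable (II `*` II : set (mR * mR)).
Proof. exact: measurableX. Qed.

Let meta : measurable_fun setT (sec dist (II `*` II)).
Proof. exact: (measurable_sec measurable_dist dist_ge0 mS12). Qed.

Let eta0 t : 0 <= sec dist (II `*` II) t.
Proof. exact: (sec_ge0 _ _ dist_ge0). Qed.

Let int_eta (G : set mR) : measurable G -> \int[lam]_(t in G) sec dist (II `*` II) t <= N.
Proof.
move=> mG; rewrite -(integral_sec measurable_dist dist_ge0 mS12 mG).
apply: ge0_subset_integral => //; first exact: measurableX.
  by apply/measurable_EFinP; exact: measurable_dist.
by move=> x _; rewrite lee_fin dist_ge0.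
Qed.

Let mlate : measurable (`]2^-1%R, 1%R]%classic : set mR).
Proof. exact: measurable_itv. Qed.

Let late_II : `]2^-1%R, 1%R] `<=` II.
Proof.
move=> t; rewrite /Defs.II/= !in_itv/= => /andP[t0 ->]; rewrite andbT.
by apply: le_trans (ltW t0); rewrite invr_ge0.
Qed.

Let lam_late : lam `]2^-1%R, 1%R]%classic = (2^-1)%R%:E.
Proof.
rewrite [LHS]lebesgue_measure_itv/= lte_fin invf_lt1// ltr1n -EFinB.
by congr EFin; lra.
Qed.

Let lam_early : lam (I0 2^-1%R) = (2^-1)%R%:E.
Proof. by rewrite [LHS]lebesgue_measure_itv/= lte_fin invr_gt0 ltr0n oppr0 adde0. Qed.

(** The late estimate, integrated over an interval of length 1/2, gives |A - B| / 2 <= 3 N, that is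
    |A - B| <= 6 N at every point of the square. The early estimate, integrated over the other half,
    then gives 3 N + 6 N / 2 = 6 N. *)
Lemma corner_mass_le : eps%:E * corner_mass c <= 6%:E * N.
Proof.
have [A copA goodA] := simplified_good CC simC.
have [B copB goodB] := simplified_good CE simE.
have good : {ae lam, forall t, II t -> good_section c A t /\ good_section e B t}.
  by apply: (aeS2 (mu := lam) _ goodA goodB) => t h1 h2 It; split; [exact: h1|exact: h2].
have eps0 : (0 <= eps)%R by case/andP: eps01.
have three0 : 0 <= 3%:E :> \bar R by rewrite lee_fin.
have AB (p q : R) : II p -> II q -> (`|A p q - B p q| <= 6 * fine N)%R.
  move=> Ip Iq; have : \int[lam]_(t in `]2^-1%R, 1%R]) (cst `|A p q - B p q|%:E t) <=
      \int[lam]_(t in `]2^-1%R, 1%R]) (3%:E * sec dist (II `*` II) t).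
    apply: ae_ge0_le_integral => //.
    - by move=> t _; rewrite lee_fin.
    - by move=> t _; rewrite mule_ge0.
    - by apply: measurable_funTS; apply: measurable_funeM.
    apply: (aeS (mu := lam) _ good) => t h Dt; have [h1 h2] := h (late_II Dt).
    apply: (late_estimate pdfc pdfe eps01 copA copB h1 h2) => //.
    by move: Dt; rewrite /= in_itv/= => /andP[].
  rewrite integral_cst// [X in _ * X <= _]lam_late ge0_integralZl_EFin//; last exact: measurable_funTS.
  move=> h; have {}h := le_trans h (lee_wpmul2l three0 (int_eta mlate)).
  move: h; rewrite -(fineK N_fin) -!EFinM lee_fin => h; lra.
have s0 : (0 <= fine N)%R by apply: fine_ge0; apply: integral_ge0 => x _; rewrite lee_fin dist_ge0.
have mI := measurable_I0 (2^-1%R : R).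
have mII2 : measurable (I0 2^-1%R `*` I0 2^-1%R : set (mR * mR)) by exact: measurableX.
have mpos : measurable_fun setT (pert_pos c) by exact: measurable_pert_pos.
have pos0 x : (0 <= pert_pos c x)%R by exact: pert_pos_ge0.
have early_II : I0 2^-1%R `<=` II.
  by apply: I0_sub; rewrite /Defs.II/= in_itv/=; apply/andP; split; lra.
have -> : eps%:E * corner_mass c =
    \int[lam]_(t in I0 2^-1%R) (eps%:E * sec (pert_pos c) (I0 2^-1%R `*` I0 2^-1%R) t).
  rewrite ge0_integralZl_EFin//; last 2 first.
  - by move=> t _; exact: sec_ge0.
  - by apply: measurable_funTS; exact: measurable_sec.
  by rewrite -integral_sec.
apply: (@le_trans _ _ (\int[lam]_(t in I0 2^-1%R)
    (3%:E * sec dist (II `*` II) t + cst (6 * fine N)%R%:E t))).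
  apply: ae_ge0_le_integral => //.
  - by move=> t _; rewrite mule_ge0// sec_ge0.
  - by apply: measurable_funTS; apply: measurable_funeM; exact: measurable_sec.
  - by move=> t _; rewrite adde_ge0// ?mule_ge0// lee_fin mulr_ge0.
  - by apply: emeasurable_funD => //; apply: measurable_funTS; apply: measurable_funeM.
  apply: (aeS (mu := lam) _ good) => t h Dt; have [h1 h2] := h (early_II _ Dt).
  by apply: (early_estimate pdfc pdfe eps01 copB h1 h2 AB).
rewrite ge0_integralD//; last 3 first.
- by move=> t _; rewrite mule_ge0.
- by apply: measurable_funTS; apply: measurable_funeM.
- by move=> t _; rewrite lee_fin mulr_ge0.
rewrite integral_cst// [X in _ + _ * X <= _]lam_early ge0_integralZl_EFin//; last exact: measurable_funTS.
apply: (@le_trans _ _ (3%:E * N + (6 * fine N)%R%:E * (2^-1)%R%:E)).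
  by apply: leeD => //; apply: lee_wpmul2l => //; exact: int_eta.
rewrite -(fineK N_fin) -!EFinM -EFinD lee_fin; lra.
Qed.

End simplified_pair.

(** Balls in L1 are open for the divergence, even around a [d] that is only measurable. This allows
    membership in the closure to be tested on such balls. *)
Lemma L1_ball_KLopen (d : T3 -> R) (r : R) : measurable_fun setT d ->
  KLopen [set F : R -> R -> R -> R | C3acpos F /\
    \int[lam3]_x (abs_diff (cube_dens F) d x)%:E < r%:E].
Proof.
move=> md; split; first by move=> F [].
move=> F [CF Fr]; have [mf _ _ _] := cube_dens_pdf CF.
pose n := \int[lam3]_x (abs_diff (cube_dens F) d x)%:E.
have n0 : 0 <= n by apply: integral_ge0 => x _; rewrite lee_fin normr_ge0.
have nfin : n \is a fin_num by rewrite ge0_fin_numE//; exact: lt_trans Fr (ltry _).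
pose gap := (r - fine n)%R.
have gap0 : (0 < gap)%R by rewrite subr_gt0 -lte_fin fineK.
(* With [del = gap / 8] the two terms of [L1_le_KL] are both gap / 4, so half of the gap to the
   radius is left. *)
exists (gap ^+ 2 / 16)%R; first by rewrite divr_gt0// exprn_gt0.
move=> G CG klG; split => //; have [mg _ _ _] := cube_dens_pdf CG.
have del0 : (0 < gap / 8)%R by rewrite divr_gt0.
have := L1_le_KL CF CG del0 klG.
have -> : (gap ^+ 2 / 16 / (2 * (gap / 8)) + 2 * (gap / 8) = gap / 2)%R by field; rewrite gt_eqF.
move=> GF; apply: (@le_lt_trans _ _ (\int[lam3]_x
    (`|cube_dens G x - cube_dens F x|%:E + (abs_diff (cube_dens F) d x)%:E))).
  apply: ge0_le_integral => //.
  - by move=> x _; rewrite lee_fin normr_ge0.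
  - by apply/measurable_EFinP; apply: measurableT_comp => //; exact: measurable_funB.
  - by apply: emeasurable_funD; apply/measurable_EFinP; apply: measurableT_comp => //; exact: measurable_funB.
  by move=> x _; rewrite -EFinD lee_fin; exact: ler_distD.
have m1 : measurable_fun setT (fun x => `|cube_dens G x - cube_dens F x|%:E : \bar R).
  by apply/measurable_EFinP; apply: measurableT_comp => //; exact: measurable_funB.
have m2 : measurable_fun setT (fun x => (abs_diff (cube_dens F) d x)%:E).
  by apply/measurable_EFinP; apply: measurableT_comp => //; exact: measurable_funB.
have p1 x : [set: T3] x -> 0 <= `|cube_dens G x - cube_dens F x|%:E by rewrite lee_fin.
have p2 x : [set: T3] x -> 0 <= (abs_diff (cube_dens F) d x)%:E by rewrite lee_fin normr_ge0.
rewrite ge0_integralD//.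
apply: (@le_lt_trans _ _ ((gap / 2)%:E + n)); first exact: leeD2r.
rewrite -(fineK nfin) -EFinD lte_fin.
move: gap0; rewrite /gap; lra.
Qed.

End separation.

Local Close Scope ereal_scope.

Theorem theorem3p11 (R : realType) :
  KL_nowhere_dense (C3acpos (R:=R) `&` [set C | simplified C]).
Proof.
apply/seteqP; split => // C0 [U [openU UC0 Usub]]; exfalso.
(* [C0] itself is only in the closure; openness of [U] yields a simplified copula in [U], and the
   perturbation starts from that one. *)
have [_ clC0] := Usub _ UC0; have [C UC [CC simC]] := clC0 U openU UC0.
have [eps0 eps0_gt0 ballC] := openU.2 C UC.
(* Since e <= 1/2, the divergence is at most e (1 + e) <= 3 e / 2 <= 3 eps0 / 8, so the perturbed
   copula stays in [U]. *)
pose e : R := Num.min 2^-1 (eps0 / 4).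
have e0 : 0 < e by rewrite lt_min invr_gt0 ltr0n divr_gt0.
have e_half : e <= 2^-1 by rewrite ge_min lexx.
have e_eps : e <= eps0 / 4 by rewrite ge_min lexx orbT.
have e01 : 0 <= e < 1 by apply/andP; split; lra.
pose D := pert_copula C e.
have CD : C3acpos D := pert_copula_C3acpos CC e01.
have UD : U D.
  apply: ballC => //; apply: (Order.POrderTheory.le_lt_trans (KL_pert_copula_le CC e01)).
  by rewrite lte_fin; nra.
have [_ clD] := Usub _ UD.
have pdfc := cube_dens_pdf CC.
have pdfd := pert_pdf pdfc e01.
have md : measurable_fun setT (pert (cube_dens C) e) by case: pdfd.
have rho0 := corner_mass_gt0 pdfc (cube_dens_gt0 CC).
have rho_fin : corner_mass (cube_dens C) \is a fin_num.
  have [mc c0 _ c1] := pdfc; rewrite ge0_fin_numE ?ltW//.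
  apply: (@le_lt_trans _ _ (\int[@lam3 R]_x (cube_dens C x)%:E)%E); last by rewrite c1 ltry.
  have mpos : measurable_fun setT (fun x => (pert_pos (cube_dens C) x)%:E).
    by apply/measurable_EFinP; exact: measurable_pert_pos.
  apply: (@le_trans _ _ (\int[@lam3 R]_x (pert_pos (cube_dens C) x)%:E)%E).
    apply: ge0_subset_integral => //; first exact: measurable_box.
    by move=> x _; rewrite lee_fin pert_pos_ge0.
  apply: ge0_le_integral => //.
  - by move=> x _; rewrite lee_fin pert_pos_ge0.
  - exact/measurable_EFinP.
  - by move=> x _; rewrite lee_fin pert_pos_le.
pose rho := fine (corner_mass (cube_dens C)).
have rho_gt0 : 0 < rho by rewrite fine_gt0// rho0 -ge0_fin_numE ?ltW.
have er : 0 < e * rho by rewrite mulr_gt0.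
(* Half of the critical radius e rho / 6: within distance [r], [corner_mass_le] would give e rho <=
   6 r = e rho / 2. *)
pose r := e * rho / 12.
(* The ball is centred at the function [pert], which agrees almost everywhere with the chosen
   density of [D]; hence [D] lies in the ball at distance 0. *)
have [|E [CE Er] [_ simE]] := clD _ (L1_ball_KLopen r md).
  split => //; rewrite (_ : (\int[_]_x _)%E = 0%E); first by rewrite lte_fin /r divr_gt0.
  rewrite -(integral0 (@lam3 R) setT); apply: ae_eq_integral => //.
    apply/measurable_EFinP; apply: measurableT_comp => //.
    by apply: measurable_funB => //; have [] := cube_dens_pdf CD.
  apply: (aeS (mu := @lam3 R) _ (pert_copula_dens CC e01)) => x h _.
  by rewrite /abs_diff h subrr normr0.
have := corner_mass_le CC CE e01 simC simE; rewrite leNgt => /negP; apply.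
rewrite -(fineK rho_fin) -/rho -EFinM.
apply: (@lt_le_trans _ _ (6%:E * r%:E)%E).
  by rewrite lte_pmul2l// lte_fin.
by rewrite -EFinM lee_fin /r; lra.
Qed.
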